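(* As $n\to\infty$, we have $$p(n,n)=\exp\left(\left(\frac{\pi}{\sqrt3}+o(1)\right)n\sqrt{\log n}\right).$$
   Context: For positive integers $m,n$, let $R=[0,m]\times[0,n]\subset\mathbb{R}^2$. All rectangles have sides parallel to the coordinate axes. A partition of the rectangle $R$ is a multiset of rectangles $\{R_i\}_{i\in I}$ such that: (1) each $R_i$ has positive integer side lengths; (2) rectangles of sizes $k\times l$ and $l\times k$ are regarded as indistinguishable; (3) all the rectangles of the multiset can be arranged so that they cover exactly $R$ and their interiors are pairwise disjoint. Two partitions are the same if they are equal as multisets (of rectangle types, up to rotation); the geometric arrangement is irrelevant. $p(m,n)$ denotes the number of partitions of the $m\times n$ rectangle. *)

(* Defs.v *)
From HB Require Import structures.
From mathcomp Require Import all_boot all_order all_algebra.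
From mathcomp Require Import finmap multiset.
From mathcomp Require Import all_classical all_reals all_analysis.
Set Implicit Arguments.
Unset Strict Implicit.
Unset Printing Implicit Defensive.
Import Order.TTheory GRing.Theory Num.Theory numFieldNormedType.Exports.
Local Open Scope classical_set_scope.
Local Open Scope ring_scope.

(* The axis-parallel rectangle of width d.1 and height d.2 whose lower left
   corner is the point c of the plane. *)
Definition rect (R : realType) (c : R * R) (d : nat * nat) : set (R * R) :=
  `[c.1, c.1 + d.1%:R] `*` `[c.2, c.2 + d.2%:R].

(* Size up to rotation: k x l and l x k are both represented by the pair
   (min(k, l), max(k, l)). *)
Definition rect_type (d : nat * nat) : nat * nat :=
  (minn d.1 d.2, maxn d.1 d.2).

(* The corners c i are arbitrary points of the plane; only the side lengths
   are required to be integers. *)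
Definition is_arrangement (R : realType) (m n N : nat)
    (c : 'I_N -> R * R) (d : 'I_N -> nat * nat) : Prop :=
  [/\ forall i, (0 < (d i).1)%N /\ (0 < (d i).2)%N,
      \bigcup_(i in [set: 'I_N]) rect (c i) (d i) = rect (0, 0) (m, n) &
      trivIset [set: 'I_N] (fun i => interior (rect (c i) (d i)))].

Definition is_partition (R : realType) (m n : nat)
    (M : multiset (nat * nat)%type) : Prop :=
  exists (N : nat) (c : 'I_N -> R * R) (d : 'I_N -> nat * nat),
    is_arrangement m n c d /\
    M = seq_mset [seq rect_type (d i) | i <- enum 'I_N].

(* fset_set returns the empty set on infinite sets; this does not interfere
   here, since by comparing areas an m x n rectangle has finitely many
   partitions. *)
Definition num_partitions (R : realType) (m n : nat) : nat :=
  #|` fset_set [set M | @is_partition R m n M] |%fset.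

(* Main.v *)
Require Import Defs.
From HB Require Import structures.
From mathcomp Require Import all_boot all_order all_algebra.
From mathcomp Require Import finmap multiset.
From mathcomp Require Import all_classical all_reals all_analysis.
From mathcomp Require Import zify ring lra.
Import Order.TTheory GRing.Theory Num.Theory numFieldNormedType.Exports.
Set Implicit Arguments. Unset Strict Implicit. Unset Printing Implicit Defensive.

(** To first order only the areas of the rectangles matter.

    A partition is a function giving a multiplicity to every type k x l with
    k <= l <= n, and its total area is n ^ 2. Weighting multiplicity functions
    by exp (- s * area) gives a product of geometric series, whose logarithm,
    the free energy, is the sum of - ln (1 - exp (- s k l)) over the types.
    Expanding the logarithm and summing over l first, each k contributes about
    (pi ^ 2 / 6) / (s k); the sum over k produces ln n, and half of the pairs
    have k <= l, so the free energy is close to Lambda / s with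
    Lambda = (pi ^ 2 / 12) ln n.

    Upper bound ([num_partitions_upper]): the number of functions of area at
    most n ^ 2 is at most exp (s n ^ 2 + Lambda / s) for every s > 0, and
    s = sqrt Lambda / n gives exp (2 n sqrt Lambda), where
    2 sqrt Lambda = (pi / sqrt 3) sqrt (ln n).

    Lower bound ([num_partitions_lower]): it is enough to use the types with
    k <= K < l <= L, where K is a little smaller than sqrt n and L is a small
    multiple of n. They carry almost all of the free energy
    ([free_energy_narrow_ge]), because all scales of k contribute equally to
    ln n and those below sqrt n make up the half of the pairs with k <= l. They
    are also easy to pack: for each k the rectangles of width k are stacked
    greedily into columns of width k, and every multiset of such types with
    area at most (1 - d) ^ 2 n ^ 2 fits into the square ([packable_narrow]),
    the rest being filled with unit squares. Finally, almost all the weight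
    exp (- s * area) sits on areas close to Lambda / s ^ 2, since tilting s
    slightly in either direction shows that other areas are negligible; this
    turns the value of the free energy into a lower bound for the number of
    multiplicity functions of bounded area ([tilted_count]).

    The constant pi ^ 2 / 6 comes from the sum of 1 / j ^ 2, computed from the
    identity 1 / sin ^ 2 (x / 2) + 1 / cos ^ 2 (x / 2) = 4 / sin ^ 2 x. *)

(** * Packing narrow rectangles into a square *)

(** A rectangle is a pair (lower left corner, sides), and a unit cell is named by
    its lower left corner. *)
Definition covers (i j : nat) (q : (nat * nat) * (nat * nat)) : bool :=
  (q.1.1 <= i < q.1.1 + q.2.1) && (q.1.2 <= j < q.1.2 + q.2.2).

(** Tilings are encoded by counting, for each unit cell, the rectangles that
    contain it. Juxtaposition then amounts to adding counts, and degenerate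
    boxes need no special treatment. *)
Definition tileable (W H : nat) (r : seq (nat * nat)) : Prop :=
  exists ps : seq ((nat * nat) * (nat * nat)),
    perm_eq [seq q.2 | q <- ps] r /\
    forall i j, count (covers i j) ps = (i < W) && (j < H).

(** Unit squares serve as filler: they are not among the types that are counted,
    so that adding them loses no information. *)
Definition packable (W H : nat) (r : seq (nat * nat)) : Prop :=
  exists u, tileable W H (r ++ nseq u (1, 1)).

Lemma tileable_perm W H r r' :
  perm_eq r r' -> tileable W H r -> tileable W H r'.
Proof. by move=> rr' [ps [h hc]]; exists ps; split=> //; apply: perm_trans rr'. Qed.

Lemma tileable1 w h : tileable w h [:: (w, h)].
Proof.
exists [:: ((0, 0), (w, h))]; split=> // i j /=.
by rewrite /covers /= addn0 !add0n.
Qed.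

Lemma tileable0w H : tileable 0 H [::].
Proof. by exists [::]; split. Qed.

Lemma tileable0h W : tileable W 0 [::].
Proof. by exists [::]; split=> // i j; rewrite andbF. Qed.

Lemma tileable_hcat W1 W2 H r1 r2 :
  tileable W1 H r1 -> tileable W2 H r2 -> tileable (W1 + W2) H (r1 ++ r2).
Proof.
move=> [p1 [e1 c1]] [p2 [e2 c2]].
exists (p1 ++ [seq ((W1 + q.1.1, q.1.2), q.2) | q <- p2]); split.
  by rewrite map_cat -map_comp perm_cat.
move=> i j; rewrite count_cat c1 count_map.
have [iW|Wi] := ltnP i W1.
  rewrite (eq_count (a2 := pred0)); first by rewrite count_pred0; lia.
  by move=> q; rewrite /= /covers /=; lia.
rewrite (eq_count (a2 := covers (i - W1) j)); first by rewrite c2; lia.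
by move=> q; rewrite /= /covers /=; lia.
Qed.

Lemma tileable_vcat W H1 H2 r1 r2 :
  tileable W H1 r1 -> tileable W H2 r2 -> tileable W (H1 + H2) (r1 ++ r2).
Proof.
move=> [p1 [e1 c1]] [p2 [e2 c2]].
exists (p1 ++ [seq ((q.1.1, H1 + q.1.2), q.2) | q <- p2]); split.
  by rewrite map_cat -map_comp perm_cat.
move=> i j; rewrite count_cat c1 count_map.
have [jH|Hj] := ltnP j H1.
  rewrite (eq_count (a2 := pred0)); first by rewrite count_pred0; lia.
  by move=> q; rewrite /= /covers /=; lia.
rewrite (eq_count (a2 := covers i (j - H1))); first by rewrite c2; lia.
by move=> q; rewrite /= /covers /=; lia.
Qed.

Lemma packable_perm W H r r' :
  perm_eq r r' -> packable W H r -> packable W H r'.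
Proof.
by move=> rr' [u h]; exists u; apply: tileable_perm h; rewrite perm_cat2r.
Qed.

Lemma perm_cat_units (r1 r2 : seq (nat * nat)) u1 u2 :
  perm_eq ((r1 ++ nseq u1 (1, 1)) ++ r2 ++ nseq u2 (1, 1))
          ((r1 ++ r2) ++ nseq (u1 + u2) (1, 1)).
Proof. by rewrite nseqD -catA -catA perm_cat2l perm_catCA. Qed.

Lemma packable_hcat W1 W2 H r1 r2 :
  packable W1 H r1 -> packable W2 H r2 -> packable (W1 + W2) H (r1 ++ r2).
Proof.
move=> [u1 h1] [u2 h2]; exists (u1 + u2).
exact: tileable_perm (perm_cat_units _ _ _ _) (tileable_hcat h1 h2).
Qed.

Lemma packable_vcat W H1 H2 r1 r2 :
  packable W H1 r1 -> packable W H2 r2 -> packable W (H1 + H2) (r1 ++ r2).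
Proof.
move=> [u1 h1] [u2 h2]; exists (u1 + u2).
exact: tileable_perm (perm_cat_units _ _ _ _) (tileable_vcat h1 h2).
Qed.

Lemma packable_nil W H : packable W H [::].
Proof.
elim: W => [|W IH]; first by exists 0; exact: tileable0w.
rewrite -[W.+1]addn1; apply: (@packable_hcat _ _ _ [::] [::]) => //.
elim: H {IH} => [|H IH]; first by exists 0; exact: tileable0h.
rewrite -[H.+1]addn1; apply: (@packable_vcat _ _ _ [::] [::]) => //.
by exists 1; exact: tileable1.
Qed.

Lemma packable_column k H b :
  sumn b <= H -> packable k H [seq (k, l) | l <- b].
Proof.
elim: b H => [|l b IH] H /= bH; first exact: packable_nil.
rewrite (_ : H = l + (H - l)); last by lia.
rewrite -cat1s; apply: packable_vcat; last by apply: IH; lia.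
by exists 0; rewrite cats0; exact: tileable1.
Qed.

(** Greedy filling: a height goes into the current bin if it fits and opens a new
    bin otherwise. A bin is left behind only when it is filled above H - L, which
    bounds the number of bins. *)
Lemma first_fit H L (ls : seq nat) : L < H -> all (leq^~ L) ls ->
  exists bs : seq (seq nat), [/\ flatten bs = ls, all (fun b => sumn b <= H) bs
    & size bs * (H - L) <= sumn ls + (H - L)].
Proof.
move=> LH lsL.
(* Every bin but the first one is filled above height H - L. *)
suff [b [bs [/= e hb hbs hl]]] : exists b bs,
    [/\ flatten (b :: bs) = ls, sumn b <= H, all (fun b => sumn b <= H) bs
      & size bs * (H - L) + sumn b <= sumn ls].
  by exists (b :: bs); rewrite /= e hb; split=> //; lia.
elim: ls lsL => [|l ls IH] /=; first by exists [::], [::].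
move=> /andP[lL /IH[b [bs [/= e hb hbs hl]]]].
have [fits|full] := leqP (l + sumn b) H.
  exists (l :: b), bs; rewrite /= -e /=; split=> //; move: hl; rewrite -e /=; lia.
exists [:: l], (b :: bs); rewrite /= ?e ?hb ?hbs; split=> //; lia.
Qed.

(** Each bin of heights becomes one column of width k. *)
Lemma packable_same_width k H L (ls : seq nat) :
  L < H -> all (leq^~ L) ls ->
  exists2 W, W * (H - L) <= k * sumn ls + k * (H - L)
    & packable W H [seq (k, l) | l <- ls].
Proof.
move=> LH /(first_fit LH)[bs [<- hH hs]]; exists (size bs * k); first by nia.
elim: bs hH {hs} => [|b bs IH] /=; first by rewrite mul0n; exists 0; exact: tileable0w.
move=> /andP[hb /IH hbs]; rewrite mulSn map_cat.
by apply: packable_hcat => //; exact: packable_column.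
Qed.

Definition area (r : seq (nat * nat)) : nat := \sum_(q <- r) q.1 * q.2.

(** Columns are built separately for every width up to K. A column may waste a
    height of L, and for each width one column may be almost empty; these
    exceptional columns have total width at most 1 + ... + K <= K * K. *)
Lemma packable_narrow K n L (r : seq (nat * nat)) :
  L < n -> all (fun q => (0 < q.1 <= K) && (q.2 <= L)) r ->
  area r + (n - L) * (K * K) <= (n - L) * n -> packable n n r.
Proof.
move=> Ln rKL har.
suff [W hW hp] : exists2 W,
    W * (n - L) <= area r + (n - L) * (K * K) & packable W n r.
  have Wn : W <= n.
    rewrite -(leq_pmul2r (m := n - L)); last by lia.
    by rewrite (leq_trans hW)// [n * _]mulnC.
  have := packable_hcat hp (packable_nil (n - W) n).
  by rewrite cats0 subnKC.
elim: K r rKL {har} => [|K IH] r rKL.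
  case: r rKL => [_|q r /=]; last by lia.
  by exists 0; [rewrite mul0n | exact: packable_nil].
set a := fun q : nat * nat => q.1 == K.+1.
have eqr : perm_eq (seq.filter a r ++ seq.filter (predC a) r) r by rewrite perm_filterC.
have [|W1 hW1 hp1] := IH (seq.filter (predC a) r).
  rewrite all_filter; apply: sub_all rKL => q /=; rewrite /a; lia.
have e1 : [seq (K.+1, l) | l <- [seq q.2 | q <- seq.filter a r]] = seq.filter a r.
  rewrite -map_comp -[RHS]map_id; apply/eq_in_map => -[k l].
  by rewrite mem_filter /a /= => /andP[/eqP-> _].
have [|W2 hW2] := @packable_same_width K.+1 n L [seq q.2 | q <- seq.filter a r] Ln.
  rewrite all_map all_filter; apply: sub_all rKL => q /=; lia.
rewrite e1 => hp2; exists (W2 + W1); last first.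
  exact: packable_perm eqr (packable_hcat hp2 hp1).
rewrite /area -(perm_big _ eqr) big_cat /=.
have -> : \sum_(q <- seq.filter a r) q.1 * q.2
    = K.+1 * sumn [seq q.2 | q <- seq.filter a r].
  rewrite sumnE big_map big_distrr /= !big_filter.
  by apply: eq_bigr => q /eqP->.
rewrite /area in hW1; nia.
Qed.

Local Open Scope classical_set_scope.
Local Open Scope ring_scope.

(** * Arrangements in the plane *)

Lemma interior_rectP (R : realType) (c : R * R) (d : nat * nat) (p : R * R) :
  interior (rect c d) p <->
  (c.1 < p.1 < c.1 + d.1%:R) && (c.2 < p.2 < c.2 + d.2%:R).
Proof.
have itvE (a x : R) k :
    (`[a, a + k%:R]%classic)° x = (a < x < a + k%:R) :> Prop.
  by rewrite interior_itv_bnd /= in_itv.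
split=> [[[A B] /= [nA nB] AB]|/andP[h1 h2]]; last first.
  exists (`[c.1, c.1 + d.1%:R]%classic, `[c.2, c.2 + d.2%:R]%classic) => //.
  by split; rewrite /= -[nbhs _ _]/((_°) _) itvE.
have nA' : nbhs p.1 `[c.1, c.1 + d.1%:R]%classic.
  apply: filterS nA => x Ax.
  by have [] := AB (x, p.2) (conj Ax (nbhs_singleton nB)).
have nB' : nbhs p.2 `[c.2, c.2 + d.2%:R]%classic.
  apply: filterS nB => x Bx.
  by have [] := AB (p.1, x) (conj (nbhs_singleton nA) Bx).
by apply/andP; split; [rewrite -itvE | rewrite -itvE].
Qed.

(** The open rectangles are disjoint and contained in the big one, so that their
    planar Lebesgue measures can be compared. *)
Lemma arrangement_area (R : realType) m n N (c : 'I_N -> R * R) d :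
  is_arrangement m n c d -> (\sum_i (d i).1 * (d i).2 <= m * n)%N.
Proof.
case=> pos cov dis.
pose mu := ((@lebesgue_measure R) \x (@lebesgue_measure R))%E.
pose A i := `](c i).1, (c i).1 + (d i).1%:R[%classic `*`
            `](c i).2, (c i).2 + (d i).2%:R[%classic.
have itv_len (x : R) k (b1 b2 : bool) :
    lebesgue_measure [set` Interval (BSide b1 x) (BSide b2 (x + k%:R))] = k%:R%:E.
  rewrite lebesgue_measure_itv /= lte_fin ltrDl ltr0n; case: k => [|k] //=.
  by rewrite -EFinB addrAC subrr add0r.
have mA i : measurable (A i) by apply: measurableX; exact: measurable_itv.
have muA i : mu (A i) = ((d i).1 * (d i).2)%:R%:E.
  rewrite [LHS](product_measure1E lebesgue_measure lebesgue_measure);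
    [|exact: measurable_itv..].
  by rewrite natrM EFinM; congr (_ * _)%E; exact: itv_len.
have trA : trivIset [set: 'I_N] A.
  move=> i j _ _ [p [[pi1 pi2] [pj1 pj2]]]; apply: dis => //; exists p.
  rewrite /= in pi1 pi2 pj1 pj2; rewrite !in_itv /= in pi1 pi2 pj1 pj2.
  by split; apply/interior_rectP/andP.
pose box := @rect R (0, 0) (m, n).
have sub : \big[setU/set0]_(i < N) A i `<=` rect (0, 0) (m, n).
  apply: (big_ind (fun X => X `<=` rect (0, 0) (m, n))) => //.
    by move=> X Y hX hY p [/hX|/hY].
  move=> i _; rewrite -cov => p [p1 p2]; exists i => //.
  by split; [apply: subset_itv_oo_cc p1 | apply: subset_itv_oo_cc p2].
have mU : measurable (\big[setU/set0]_(i < N) A i).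
  by apply: bigsetU_measurable => i _.
have : (mu (\big[setU/set0]_(i < N) A i) <= mu box)%E.
  by apply: le_measure; rewrite ?inE//; apply: measurableX; exact: measurable_itv.
have -> : mu (\big[setU/set0]_(i < N) A i) = (\sum_(i < N) mu (A i))%E.
  pose Mu := (product_measure1 (@lebesgue_measure R) (@lebesgue_measure R)
    : {measure set _ -> \bar R}).
  exact: (@measure_bigsetU_ord _ _ _ Mu N xpredT A mA trA).
have -> : mu box = (m * n)%:R%:E.
  rewrite [LHS](product_measure1E lebesgue_measure lebesgue_measure);
    [|exact: measurable_itv..].
  by rewrite natrM EFinM; congr (_ * _)%E; exact: itv_len.
rewrite (eq_bigr _ (fun i _ => muA i)).
by rewrite sumEFin lee_fin -natr_sum ler_nat.
Qed.

Lemma arrangement_sides (R : realType) m n N (c : 'I_N -> R * R) d i :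
  is_arrangement m n c d -> ((d i).1 <= m)%N /\ ((d i).2 <= n)%N.
Proof.
case=> _ cov _.
have inbox p : rect (c i) (d i) p -> rect (0, 0) (m, n) p.
  by move=> ip; rewrite -cov; exists i.
have := inbox (c i); have := inbox ((c i).1 + (d i).1%:R, (c i).2 + (d i).2%:R).
rewrite /rect /setX /= !in_itv /= !lexx !lerDl !ler0n !add0r.
case=> // /andP[_ h1] /andP[_ h2]; case=> // /andP[h3 _] /andP[h4 _].
by rewrite -!(ler_nat R); split; lra.
Qed.

Lemma count_ge2 (T : Type) (x0 : T) (a : pred T) (s : seq T) i j :
  (i < j < size s)%N -> a (nth x0 s i) -> a (nth x0 s j) -> (1 < count a s)%N.
Proof.
elim: s i j => [|x s IH] [|i] [|j] //=; rewrite ?andbF// !ltnS.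
  move=> js -> aj; rewrite -[X in (X <= _)%N]addn1 add1n ltnS -has_count.
  by apply/(has_nthP x0); exists j.
by move=> ij ai aj; rewrite ltn_addl// (IH i j).
Qed.

(** A point of the big rectangle lies in some closed unit cell, and the tile that
    contains this cell contains the point. Conversely, if a point were interior to
    two tiles, the cell obtained by truncating its coordinates would be counted
    twice. *)
Lemma tileable_partition (R : realType) m n (r : seq (nat * nat)) :
  (0 < m)%N -> (0 < n)%N -> all (fun q => (0 < q.1)%N && (0 < q.2)%N) r ->
  tileable m n r -> is_partition R m n (seq_mset [seq rect_type q | q <- r]).
Proof.
move=> m0 n0 rpos [ps [psr cnt]].
have q0 : (nat * nat) * (nat * nat) := ((0, 0), (0, 0))%N.
pose q (i : 'I_(size ps)) := nth q0 ps i.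
pose c i : R * R := ((q i).1.1%:R, (q i).1.2%:R).
pose d i := (q i).2.
have dpos i : (0 < (d i).1)%N && (0 < (d i).2)%N.
  move: rpos; rewrite -(perm_all _ psr) all_map => /(all_nthP q0)/(_ i).
  by apply; exact: ltn_ord.
have enumE : [seq q i | i <- enum 'I_(size ps)] = ps.
  by rewrite /q (map_comp (nth q0 ps) val) val_enum_ord; exact: mkseq_nth.
have cell_in i x y : covers x y (q i) -> (x < m)%N /\ (y < n)%N.
  move=> xy; have : (0 < count (covers x y) ps)%N.
    by rewrite -has_count; apply/(has_nthP q0); exists i.
  by rewrite cnt; lia.
have qin i : ((q i).1.1 + (q i).2.1 <= m)%N /\ ((q i).1.2 + (q i).2.2 <= n)%N.
  have := dpos i; rewrite /d => dp.
  have := @cell_in i ((q i).1.1 + (q i).2.1).-1 ((q i).1.2 + (q i).2.2).-1.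
  by rewrite /covers; lia.
exists (size ps), c, d; split; last first.
  apply/eq_seq_msetP; rewrite (map_comp rect_type d) perm_map//.
  by rewrite perm_sym /d (map_comp snd q) enumE.
split.
- by move=> i; apply/andP.
- apply/seteqP; split=> p.
    case=> i _ [/=]; rewrite !in_itv /= => /andP[a1 a2] /andP[b1 b2].
    have [h1 h2] := qin i; rewrite -!(ler_nat R) !natrD in h1 h2.
    have := ler0n R (q i).1.1; have := ler0n R (q i).1.2 => *.
    by split; rewrite /= in_itv /= add0r; apply/andP; split; lra.
  case=> /=; rewrite !in_itv /= !add0r => /andP[a1 a2] /andP[b1 b2].
  have cell (x : R) k : (0 < k)%N -> 0 <= x <= k%:R ->
      exists2 a, (a < k)%N & a%:R <= x <= a.+1%:R.
    move=> k0 /andP[x0 xk]; have [xltk|kx] := ltP x k%:R.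
      exists (Num.truncn x); first by rewrite truncn_lt_nat.
      by have /andP[-> /ltW] := truncn_itv x0.
    exists k.-1; first by lia.
    by rewrite prednK// xk andbT (le_trans _ kx)// ler_nat leq_pred.
  have [x xm hx] := cell p.1 m m0 (introT andP (conj a1 a2)).
  have [y yn hy] := cell p.2 n n0 (introT andP (conj b1 b2)).
  have : (0 < count (covers x y) ps)%N by rewrite cnt xm yn.
  rewrite -has_count => /(has_nthP q0)[i ilt].
  rewrite -[i]/(nat_of_ord (Ordinal ilt)); set o := Ordinal ilt.
  rewrite -/(q o) /covers => /andP[/andP[c1 c2] /andP[c3 c4]].
  exists o => //; move: c1 c2 c3 c4 hx hy; rewrite -!(ler_nat R) !natrD.
  by move=> *; split; rewrite /= in_itv /=; lra.
- move=> i j _ _ [p [/interior_rectP hi /interior_rectP hj]].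
  have p0 : 0 <= p.1 /\ 0 <= p.2.
    move: hi; rewrite /c /=; have := ler0n R (q i).1.1.
    by have := ler0n R (q i).1.2 => *; lra.
  have cov k : (c k).1 < p.1 < (c k).1 + (d k).1%:R ->
      (c k).2 < p.2 < (c k).2 + (d k).2%:R ->
      covers (Num.truncn p.1) (Num.truncn p.2) (q k).
    rewrite /c /d /= => /andP[h1 h2] /andP[h3 h4]; rewrite /covers.
    rewrite !truncn_ge_nat ?truncn_lt_nat ?natrD; try by case: p0.
    by rewrite h2 h4 (ltW h1) (ltW h3).
  have {}hi := cov i (proj1 (andP hi)) (proj2 (andP hi)).
  have {}hj := cov j (proj1 (andP hj)) (proj2 (andP hj)).
  have le1 := cnt (Num.truncn p.1) (Num.truncn p.2).
  apply/val_inj/eqP; rewrite eqn_leq leqNgt [X in _ && X]leqNgt; apply/andP; split.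
    apply/negP => ji; have := @count_ge2 _ q0 _ ps j i _ hj hi.
    by rewrite le1 ji ltn_ord => /(_ isT); case: (_ && _).
  apply/negP => ij; have := @count_ge2 _ q0 _ ps i j _ hi hj.
  by rewrite le1 ij ltn_ord => /(_ isT); case: (_ && _).
Qed.

(** * Partitions as multiplicity functions *)

(** A partition is described by the multiplicities of the types, which range over
    the pairs (k, l) with k, l <= n satisfying P. *)
Definition tile_type (n : nat) (P : pred (nat * nat)) : finType :=
  {t : 'I_n.+1 * 'I_n.+1 | P (val t.1, val t.2)}.

Definition dims n P (t : tile_type n P) : nat * nat :=
  (nat_of_ord (val t).1, nat_of_ord (val t).2).

Definition tiles n P B (m : {ffun tile_type n P -> 'I_B.+1}) : seq (nat * nat) :=
  flatten [seq nseq (m t) (dims t) | t <- index_enum (tile_type n P)].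

Definition total_area n P B (m : {ffun tile_type n P -> 'I_B.+1}) : nat :=
  (\sum_t m t * ((dims t).1 * (dims t).2))%N.

Lemma dims_inj n P : injective (@dims n P).
Proof.
move=> [[k l] h] [[k' l'] h'] [kk ll].
by apply/val_inj; congr pair; apply/val_inj.
Qed.

Lemma dimsP n P (t : tile_type n P) : P (dims t).
Proof. exact: (valP t). Qed.

Lemma dims_surj n (P : pred (nat * nat)) k l :
  P (k, l) -> (k <= n)%N -> (l <= n)%N -> exists t : tile_type n P, dims t = (k, l).
Proof.
move=> Pkl kn ln.
have h : P (val (inord k : 'I_n.+1), val (inord l : 'I_n.+1)) by rewrite /= !inordK.
by exists (exist _ (inord k, inord l) h); rewrite /dims /= !inordK.
Qed.

Lemma count_tiles n P B (m : {ffun tile_type n P -> 'I_B.+1}) x :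
  count_mem x (tiles m) = (\sum_t (dims t == x) * m t)%N.
Proof.
rewrite /tiles count_flatten sumnE !big_map. 
by apply: eq_bigr => t _ /=; rewrite count_nseq.
Qed.

Lemma count_tiles_dims n P B (m : {ffun tile_type n P -> 'I_B.+1}) t :
  count_mem (dims t) (tiles m) = m t.
Proof.
rewrite count_tiles (bigD1 t)//= eqxx mul1n big1 ?addn0// => s st.
by rewrite (inj_eq (@dims_inj n P)) (negbTE st).
Qed.

Lemma area_tiles n P B (m : {ffun tile_type n P -> 'I_B.+1}) :
  area (tiles m) = total_area m.
Proof.
rewrite /area /tiles big_flatten big_map; apply: eq_bigr => t _ /=.
by rewrite big_nseq iter_addn_0 mulnC.
Qed.

Lemma all_tiles n P B (m : {ffun tile_type n P -> 'I_B.+1}) : all P (tiles m).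
Proof.
apply/allP => q /flatten_mapP[t _]; rewrite mem_nseq => /andP[_ /eqP ->].
exact: dimsP.
Qed.

Definition oriented (q : nat * nat) : bool := (0 < q.1 <= q.2)%N.

(** Sides are at most n by inclusion and multiplicities at most n * n by
    comparison of areas, so finitely many multiplicity functions describe all
    partitions. *)
Lemma partition_tiles (R : realType) n M : is_partition R n n M ->
  exists m : {ffun tile_type n oriented -> 'I_(n * n).+1},
    M = seq_mset (tiles m) /\ (total_area m <= n * n)%N.
Proof.
case=> [N [c [d [arr ->]]]]; set s := map _ _.
have area_s : (area s <= n * n)%N.
  rewrite /area /s big_map big_enum; apply: leq_trans (arrangement_area arr).
  by apply: leq_sum => i _; rewrite /rect_type /=; nia.
have sP q : q \in s -> oriented q /\ (q.1 <= n)%N /\ (q.2 <= n)%N.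
  move=> /mapP[i _ ->]; have [h1 h2] := arrangement_sides i arr.
  by case: arr => /(_ i) h _ _; rewrite /oriented /rect_type /=; lia.
have cnt q : (count_mem q s <= n * n)%N.
  case: (boolP (q \in s)) => [qs|]; last by move/count_memPn ->.
  apply: leq_trans area_s; rewrite /area -sum1_count big_mkcond /=.
  rewrite big_seq [X in (_ <= X)%N]big_seq.
  apply: leq_sum => x xs; case: eqP => // xq.
  by have := sP _ xs; rewrite /oriented; nia.
pose m : {ffun tile_type n oriented -> 'I_(n * n).+1} :=
  [ffun t => inord (count_mem (dims t) s)].
have pm : perm_eq (tiles m) s.
  apply/allP => q _ /=; apply/eqP; have [qs|qs] := boolP (q \in s).
    have [Pq [q1 q2]] := sP _ qs; case: q Pq q1 q2 qs => k l Pq q1 q2 qs.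
    have [t <-] := dims_surj Pq q1 q2.
    by rewrite count_tiles_dims /m ffunE inordK ?ltnS.
  rewrite (count_memPn qs) count_tiles big1// => t _.
  case: eqP => // tq; rewrite /m ffunE inordK ?ltnS// tq.
  by rewrite (count_memPn qs) muln0.
exists m; split; first by apply/eq_seq_msetP; rewrite perm_sym.
by rewrite -area_tiles /area (perm_big _ pm).
Qed.

Lemma finite_partitions (R : realType) n : finite_set [set M | @is_partition R n n M].
Proof.
apply: sub_finite_set (finite_seq [seq seq_mset (tiles m) |
  m <- enum {ffun tile_type n oriented -> 'I_(n * n).+1}]).
move=> M /= /partition_tiles[m [-> _]].
by apply/mapP; exists m; rewrite ?mem_enum.
Qed.

Lemma num_partitions_le (R : realType) n :
  (num_partitions R n n <=
   #|[pred m : {ffun tile_type n oriented -> 'I_(n * n).+1} |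
       (total_area m <= n * n)%N]|)%N.
Proof.
rewrite cardE -(size_map (fun m => seq_mset (tiles m))).
apply: uniq_leq_size => [|M]; first exact: fset_uniq.
rewrite in_fset_set ?inE /=; last exact: finite_partitions.
move=> /partition_tiles[m [-> hm]].
by apply/mapP; exists m; rewrite // mem_enum inE.
Qed.

(** The gap between the two sides makes these types oriented and different from
    the unit square. *)
Definition narrow (K L : nat) (q : nat * nat) : bool :=
  ((0 < q.1 <= K) && (K < q.2 <= L))%N.

(** The multiplicity of a narrow type can be read off from the partition even
    after unit squares have been added, which makes the packing construction
    injective. *)
Lemma num_partitions_ge (R : realType) n K L B :
  (0 < K)%N -> (L < n)%N ->
  (#|[pred m : {ffun tile_type n (narrow K L) -> 'I_B.+1} |
       (total_area m + (n - L) * (K * K) <= (n - L) * n)%N]|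
   <= num_partitions R n n)%N.
Proof.
move=> K0 Ln; set P := narrow K L.
pose read (M : multiset (nat * nat)%type) : {ffun tile_type n P -> 'I_B.+1} :=
  [ffun t => inord (M (dims t))].
rewrite cardE /num_partitions -(size_map read).
apply: uniq_leq_size => [|m]; first exact: enum_uniq.
rewrite mem_enum inE -area_tiles => har.
have mP q : q \in tiles m -> P q by apply/allP/all_tiles.
have [u tu] : packable n n (tiles m).
  apply: (@packable_narrow K n L) => //; apply/allP => q /mP.
  by rewrite /P /narrow; lia.
have n0 : (0 < n)%N by lia.
have part := tileable_partition R n0 n0 _ tu.
have {part} /part part :
    all (fun q => (0 < q.1)%N && (0 < q.2)%N) (tiles m ++ nseq u (1, 1)%N).
  apply/allP => q; rewrite mem_cat mem_nseq => /orP[/mP|/andP[_ /eqP ->]//].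
  by rewrite /P /narrow; lia.
apply/mapP; eexists.
  by rewrite in_fset_set ?inE; [exact: part | exact: finite_partitions].
apply/ffunP => t; apply/val_inj; rewrite ffunE mset_seqE map_cat count_cat.
have -> : [seq rect_type q | q <- tiles m] = tiles m.
  rewrite -[RHS]map_id; apply/eq_in_map => -[k l] /mP; rewrite /P /narrow /rect_type /=.
  by move=> ?; congr pair; lia.
rewrite count_tiles_dims map_nseq count_nseq /=.
have := dimsP t; rewrite /P /narrow; case: (dims t) => k l /=.
rewrite /rect_type /= => h; rewrite (_ : (_ == _) = false).
  by rewrite addn0 inordK.
by apply/eqP => -[_ ll]; lia.
Qed.

(** * The Basel sum *)

Lemma nonneg_derive_le (R : realType) (f df : R -> R) (a b : R) : a <= b ->
  (forall x, a <= x <= b -> is_derive x 1 f (df x)) ->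
  (forall x, a <= x <= b -> 0 <= df x) -> f a <= f b.
Proof.
rewrite le_eqVlt => /orP[/eqP -> //|ab] fd df0.
have [||x] := @MVT R f df a b ab.
- by move=> x; rewrite in_itv /= => /andP[ax xb]; apply: fd; rewrite !ltW.
- apply: derivable_within_continuous => x; rewrite in_itv /= => /fd dx.
  exact: ex_derive.
rewrite in_itv /= => /andP[ax xb] fba.
rewrite -subr_ge0 fba mulr_ge0 ?subr_ge0 ?(ltW ab)//.
by apply: df0; rewrite !ltW.
Qed.

Lemma sin_le_id (R : realType) (x : R) : 0 <= x -> sin x <= x.
Proof.
move=> x0; rewrite -subr_ge0.
have -> : 0 = (fun y : R => y - sin y) 0 by rewrite /= sin0 subr0.
apply: (@nonneg_derive_le R (fun y => y - sin y) (fun y => 1 - cos y)) => //.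

Qed.

Lemma mul_cos_le_sin (R : realType) (x : R) :
  0 <= x <= pi / 2 -> x * cos x <= sin x.
Proof.
move=> /andP[x0 xpi]; rewrite -subr_ge0.
have -> : 0 = (fun y : R => sin y - y * cos y) 0 by rewrite /= sin0 mul0r subr0.
apply: (@nonneg_derive_le R (fun y => sin y - y * cos y) (fun y => y * sin y)) => //.
  move=> y _; apply: is_derive_eq; rewrite /GRing.scale /=; ring.
move=> y /andP[y0 yx]; apply: mulr_ge0 => //; apply: sin_ge0_pi.
by rewrite y0 /=; have := pi_ge0 R; lra.
Qed.

Definition basel_sum (R : realType) (J : nat) : R :=
  \sum_(1 <= j < J.+1) (j%:R ^+ 2)^-1.

(** This is sin x <= x <= tan x, squared and inverted. *)
Lemma inv_sin2_bounds (R : realType) (x : R) : 0 < x < pi / 2 ->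
  (x ^+ 2)^-1 <= (sin x ^+ 2)^-1 <= (x ^+ 2)^-1 + 1.
Proof.
move=> /andP[x0 xpi].
have s0 : 0 < sin x by apply: sin_gt0_pihalf; rewrite x0.
have c0 : 0 <= cos x by apply: cos_ge0_pihalf; have := pi_ge0 R; lra.
have h1 := sin_le_id (ltW x0).
have h2 : x * cos x <= sin x by apply: mul_cos_le_sin; rewrite !ltW.
have h3 : sin x ^+ 2 <= x ^+ 2 by apply: lerXn2r; rewrite ?nnegrE ?(ltW s0) ?(ltW x0).
rewrite lef_pV2 ?posrE ?exprn_gt0// h3 /=.
have -> : (sin x ^+ 2)^-1 = 1 + (cos x / sin x) ^+ 2.
  have := cos2Dsin2 x; rewrite expr_div_n => e.
  by apply: (mulIf (lt0r_neq0 (exprn_gt0 2 s0)));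
    rewrite mulrDl !mulfVK ?mulVf ?mul1r ?lt0r_neq0 ?exprn_gt0// addrC.
rewrite addrC lerD2r -exprVn; have [x0' s0'] := (ltW x0, ltW s0).
apply: lerXn2r; rewrite ?nnegrE ?divr_ge0 ?invr_ge0//.
by rewrite ler_pdivrMr// ler_pdivlMl.
Qed.

(** When k stands for the angle (2 k + 1) t, where t is pi / 2 divided by twice
    the number of terms, its partner stands for the complementary angle. *)
Lemma sum_fold (R : realType) N (F : nat -> R) :
  \sum_(k < N + N) F k = \sum_(k < N) (F k + F (N + N - k.+1)%N).
Proof.
rewrite big_split_ord big_split /=; congr (_ + _).
rewrite (reindex_inj rev_ord_inj) /=; apply: eq_bigr => k _.
by congr F; have := ltn_ord k; lia.
Qed.

(** Halving these angles gives half of the angles for 2 * N; the other half is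
    made of the complementary angles. *)
Definition odd_angle (R : realType) (N k : nat) : R := (k.*2.+1)%:R * (pi / (4 * N)%:R).

Lemma odd_angle_itv (R : realType) N k : (k < N)%N ->
  0 < odd_angle R N k < pi / 2.
Proof.
move=> kN; have N0 : 0 < N%:R :> R by rewrite ltr0n; lia.
have pi0 := pi_gt0 R.
rewrite /odd_angle natrM; apply/andP; split.
  by rewrite mulr_gt0// divr_gt0// mulr_gt0.
rewrite mulrA ltr_pdivrMr ?mulr_gt0//.
have : (k.*2.+1 < 2 * N)%N by lia.
rewrite -(ltr_nat R) natrM => h; nra.
Qed.

(** By the identity 1 / sin ^ 2 (x / 2) + 1 / cos ^ 2 (x / 2) = 4 / sin ^ 2 x,
    doubling the number of angles multiplies the sum by 4. *)
Lemma sum_inv_sin2 (R : realType) p :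
  \sum_(k < 2 ^ p) (sin (odd_angle R (2 ^ p) k) ^+ 2)^-1 = 2 * (4 ^ p)%:R.
Proof.
elim: p => [|p IH].
  rewrite big_ord1 /odd_angle !mul1r muln1.
  have e : (pi / 4%:R : R) *+ 2 = pi / 2 by rewrite -mulr_natr; field.
  have := cos_mulr2n (pi / 4%:R : R); rewrite e cos_pihalf.
  have := cos2Dsin2 (pi / 4%:R : R) => h1 h2.
  have -> : sin (pi / 4%:R : R) ^+ 2 = 2^-1 by lra.
  by rewrite invrK mulr1.
rewrite expnS mul2n -addnn.
rewrite (sum_fold _ (fun k => (sin (odd_angle R (2 ^ p + 2 ^ p) k) ^+ 2)^-1)).
rewrite expnS natrM mulrCA -IH big_distrr /=.
apply: eq_bigr => k _; set N := (2 ^ p)%N in k *.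
have := odd_angle_itv R (ltn_ord k); set x := odd_angle R N k => x0.
have N0 : N%:R != 0 :> R by rewrite pnatr_eq0 /N; lia.
have N2 : N%:R + N%:R != 0 :> R by rewrite -natrD pnatr_eq0 /N; lia.
have -> : odd_angle R (N + N) k = x / 2.
  by rewrite /x /odd_angle !natrM natrD; field; rewrite ?N0 ?N2.
have -> : odd_angle R (N + N) (N + N - k.+1) = pi / 2 - x / 2.
  have kN := ltn_ord k.
  have -> : x / 2 = odd_angle R (N + N) k.
    by rewrite /x /odd_angle !natrM natrD; field; rewrite ?N0 ?N2.
  rewrite /odd_angle (_ : (N + N - k.+1).*2.+1 = (4 * N - k.*2.+1)%N); last by lia.
  rewrite natrB ?natrM ?natrD; last by lia.
  by field; rewrite ?N0 ?N2.
have -> : sin (pi / 2 - x / 2) = cos (x / 2).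
  by rewrite -cosBpihalf -[RHS]cosN; congr cos; ring.
clearbody x; have sx : 0 < sin x by apply: sin_gt0_pihalf.
have e : sin x = 2 * (cos (x / 2) * sin (x / 2)).
  have h : (x / 2) *+ 2 = x by rewrite -mulr_natr divfK ?pnatr_eq0.
  by have := sin_mulr2n (x / 2); rewrite h => ->; rewrite -mulr_natl.
have cs := cos2Dsin2 (x / 2); rewrite {}e in sx *.
set c := cos (x / 2) in sx cs *; set s := sin (x / 2) in sx cs *.
clearbody c s.
have c0 : c != 0 by apply/eqP => c0; move: sx; rewrite c0; lra.
have s0 : s != 0 by apply/eqP => s0; move: sx; rewrite s0; lra.
transitivity ((c ^+ 2 + s ^+ 2) / (c ^+ 2 * s ^+ 2)).
  by field; rewrite c0 s0.
by rewrite cs; field; rewrite c0 s0.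
Qed.

Definition odd_basel_sum (R : realType) (N : nat) : R :=
  \sum_(k < N) ((k.*2.+1)%:R ^+ 2)^-1.

Lemma basel_sum_double (R : realType) N :
  basel_sum R N.*2 = odd_basel_sum R N + basel_sum R N / 4.
Proof.
rewrite /basel_sum /odd_basel_sum; elim: N => [|N IH].
  by rewrite !big_geq// big_ord0 mul0r addr0.
rewrite doubleS big_nat_recr//= big_nat_recr//= {}IH big_ord_recr /=.
rewrite [in RHS]big_nat_recr//=.
have -> : (N.*2.+2)%:R = 2 * N.+1%:R :> R by rewrite -natrM; congr _%:R; lia.
have n0 : N.+1%:R != 0 :> R by rewrite pnatr_eq0.
have n1 : (N.*2.+1)%:R != 0 :> R by rewrite pnatr_eq0.
set a := N.+1%:R in n0 *; set b := N.*2.+1%:R in n1 *; clearbody a b.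
by field; rewrite n0 n1.
Qed.

(** Replacing 1 / sin ^ 2 x by 1 / x ^ 2 in [sum_inv_sin2] costs at most 1 per
    term, that is N out of a total of 2 * N ^ 2. *)
Lemma odd_basel_bounds (R : realType) p :
  pi ^+ 2 / 8 - pi ^+ 2 / (16 * (2 ^ p)%:R) <= odd_basel_sum R (2 ^ p)
    <= pi ^+ 2 / 8.
Proof.
set N := (2 ^ p)%N.
have N0 : 0 < N%:R :> R by rewrite ltr0n /N; lia.
have pi0 := pi_gt0 R.
have sumE : \sum_(k < N) (odd_angle R N k ^+ 2)^-1
    = odd_basel_sum R N * (4 * N%:R / pi) ^+ 2.
  rewrite /odd_basel_sum big_distrl /=; apply: eq_bigr => k _.
  have k0 : (k.*2.+1)%:R != 0 :> R by rewrite pnatr_eq0.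
  rewrite /odd_angle natrM; set a := k.*2.+1%:R in k0 *; clearbody a.
  by move: (pi : R) pi0 => P P0; field; rewrite k0 !gt_eqF.
have bnd (k : 'I_N) := inv_sin2_bounds (odd_angle_itv R (ltn_ord k)).
have up : odd_basel_sum R N * (4 * N%:R / pi) ^+ 2 <= 2 * (4 ^ p)%:R.
  rewrite -sumE -sum_inv_sin2; apply: ler_sum => k _.
  by have /andP[] := bnd k.
have lo : 2 * (4 ^ p)%:R <= odd_basel_sum R N * (4 * N%:R / pi) ^+ 2 + N%:R.
  rewrite -sumE -sum_inv_sin2.
  have -> : N%:R = \sum_(k < N) 1 :> R by rewrite sumr_const card_ord.
  rewrite -big_split /=; apply: ler_sum => k _.
  by have /andP[] := bnd k.
have e4 : (4 ^ p)%:R = N%:R ^+ 2 :> R by rewrite -natrX /N -expnM mulnC expnM.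
rewrite e4 in up lo.
have c0 : 0 < (4 * N%:R / pi) ^+ 2 :> R by rewrite exprn_gt0// divr_gt0// mulr_gt0.
apply/andP; split; rewrite -(ler_pM2r c0).
  rewrite -(lerD2r N%:R); apply: le_trans lo.
  rewrite le_eqVlt; apply/orP; left; apply/eqP.
  by move: (pi : R) pi0 => P P0; field; rewrite !gt_eqF.
apply: (le_trans up).
rewrite le_eqVlt; apply/orP; left; apply/eqP.
by move: (pi : R) pi0 => P P0; field; rewrite !gt_eqF.
Qed.

Lemma basel_sum_ndecr (R : realType) M N :
  (M <= N)%N -> basel_sum R M <= basel_sum R N.
Proof.
move=> MN; rewrite /basel_sum [leRHS](big_cat_nat (n := M.+1))//= lerDl.
by apply: sumr_ge0 => j _; rewrite invr_ge0 exprn_ge0.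
Qed.

(** From Z (2 N) = O (N) + Z (N) / 4 and Z (N) <= Z (2 N), where O is the sum over
    odd integers, Z (N) is at most 4 / 3 of pi ^ 2 / 8. *)
Lemma basel_upper (R : realType) J : basel_sum R J <= pi ^+ 2 / 6.
Proof.
have h : basel_sum R (2 ^ J) <= pi ^+ 2 / 6.
  have := basel_sum_double R (2 ^ J).
  have : basel_sum R (2 ^ J) <= basel_sum R (2 ^ J).*2.
    by apply: basel_sum_ndecr; lia.
  by have /andP[_] := odd_basel_bounds R J; lra.
by apply: le_trans h; apply: basel_sum_ndecr; rewrite ltnW// ltn_expl.
Qed.

(** By the same recursion the error at 2 ^ (p + 1) is at most a quarter of the
    error at 2 ^ p plus pi ^ 2 / (16 * 2 ^ p), and pi ^ 2 / 4 / 2 ^ p is stable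
    under this. *)
Lemma basel_lower (R : realType) p :
  pi ^+ 2 / 6 - pi ^+ 2 / 4 / (2 ^ p)%:R <= basel_sum R (2 ^ p).
Proof.
elim: p => [|p IH].
  rewrite /basel_sum expn0 big_nat1 expr1n invr1 mulr1.
  by have := sqr_ge0 (pi : R); lra.
rewrite expnS mul2n basel_sum_double.
have /andP[h _] := odd_basel_bounds R p.
have N0 : 0 < (2 ^ p)%:R :> R by rewrite ltr0n; lia.
have e8 : pi ^+ 2 / 4 / (2 ^ p).*2%:R = pi ^+ 2 / (2 ^ p)%:R / 8 :> R.
  by rewrite -mul2n natrM; field; rewrite gt_eqF.
have e16 : pi ^+ 2 / (16 * (2 ^ p)%:R) = pi ^+ 2 / (2 ^ p)%:R / 16 :> R.
  by field; rewrite gt_eqF.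
have e4 : pi ^+ 2 / 4 / (2 ^ p)%:R = pi ^+ 2 / (2 ^ p)%:R / 4 :> R.
  by field; rewrite gt_eqF.
rewrite e4 in IH; rewrite e16 in h; rewrite e8.
set a := pi ^+ 2 / (2 ^ p)%:R in h IH *; lra.
Qed.

Lemma basel_approx (R : realType) (e : R) : 0 < e ->
  exists J, pi ^+ 2 / 6 - e <= basel_sum R J.
Proof.
move=> e0; pose p := Num.truncn (pi ^+ 2 / 4 / e : R).
exists (2 ^ p)%N; apply: le_trans (basel_lower R p).
have N0 : 0 < (2 ^ p)%:R :> R by rewrite ltr0n; lia.
rewrite lerD2l lerN2 ler_pdivrMr// [e * _]mulrC -ler_pdivrMr//.
apply: (le_trans (ltW (truncnS_gt _))).
by rewrite ler_nat ltn_expl.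
Qed.

(** * Logarithms of geometric series *)

Lemma is_derive_mulf (R : realType) (f g : R -> R) (x df dg : R) :
  is_derive x 1 f df -> is_derive x 1 g dg ->
  is_derive x 1 (fun y => f y * g y) (df * g x + f x * dg).
Proof.
move=> hf hg; have h := is_deriveM hf hg.
by apply: (is_derive_eq h); rewrite /GRing.scale /= addrC [g x * _]mulrC.
Qed.

Lemma is_derive_powS (R : realType) n (x : R) :
  is_derive x 1 (fun y : R => y ^+ n.+1) (n.+1%:R * x ^+ n).
Proof.
have -> : (fun y : R => y ^+ n.+1) = (@id R) ^+ n.+1.
  by apply/funext => y; rewrite exprfctE.
have h := is_deriveX n.+1 (is_derive_id x (1 : R)).
by apply: (is_derive_eq h); rewrite /GRing.scale /= mulr1.
Qed.

Lemma is_derive_inv1B (R : realType) (x : R) : x < 1 ->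
  is_derive x 1 (fun y : R => (1 - y)^-1) ((1 - x) ^- 2).
Proof.
move=> x1; have x10 : 1 - x != 0 by rewrite gt_eqF// subr_gt0.
have d1 : is_derive x 1 (fun y : R => 1 - y) (- 1).
  by apply: is_derive_eq; rewrite /GRing.scale /=; ring.
have h := @is_deriveV R (fun y => 1 - y) _ _ _ x10 d1.
by apply: (is_derive_eq h); rewrite /GRing.scale /= mulrNN mulr1.
Qed.

(** The remainder of order J of the power series of - ln (1 - x). *)
Definition log_tail (R : realType) (J : nat) (x : R) : R :=
  - ln (1 - x) - \sum_(1 <= j < J.+1) x ^+ j / j%:R.

Lemma is_derive_log_tail (R : realType) J (x : R) : x < 1 ->
  is_derive x 1 (log_tail J) (x ^+ J / (1 - x)).
Proof.
move=> x1; have x10 : 0 < 1 - x by rewrite subr_gt0.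
elim: J => [|J IH].
  have -> : @log_tail R 0 = fun y => - ln (1 - y).
    by apply/funext => y; rewrite /log_tail big_geq// subr0.
  have dln := is_derive1_ln x10.
  have d1 : is_derive x 1 (fun y : R => 1 - y) (- 1).
    by apply: is_derive_eq; rewrite /GRing.scale /=; ring.
  have := @is_derive1_comp R (@ln R) (fun y : R => 1 - y) x _ _ dln d1.
  move=> d2; have d3 := is_deriveN d2.
  by apply: (is_derive_eq d3); rewrite expr0 /GRing.scale /=; field; rewrite gt_eqF.
have -> : @log_tail R J.+1 = fun y => log_tail J y - y ^+ J.+1 / J.+1%:R.
  by apply/funext => y; rewrite /log_tail [in LHS]big_nat_recr//= opprD addrA.
have d1 : is_derive x 1 (fun y : R => y ^+ J.+1 / J.+1%:R) (x ^+ J).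
  have h := is_derive_mulf (is_derive_powS J x) (is_derive_cst (J.+1%:R^-1 : R) x 1).
  apply: (is_derive_eq h); by rewrite mulr0 addr0 /cst /= mulrAC divff ?mul1r.
have h := is_deriveB IH d1; apply: (is_derive_eq h); rewrite exprSr.
by field; rewrite gt_eqF.
Qed.

Lemma log_tail0 (R : realType) J : log_tail J (0 : R) = 0.
Proof.
rewrite /log_tail subr0 ln1 oppr0 big_nat big1 ?subr0// => j /andP[j0 _].
by rewrite expr0n gtn_eqF// mul0r.
Qed.

Lemma log_tail_ge0 (R : realType) J (x : R) : 0 <= x < 1 -> 0 <= log_tail J x.
Proof.
move=> /andP[x0 x1]; rewrite -(log_tail0 R J).
apply: (@nonneg_derive_le R (log_tail J) (fun y => y ^+ J / (1 - y))) => //.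
  by move=> y /andP[_ yx]; apply: is_derive_log_tail; exact: le_lt_trans x1.
by move=> y /andP[y0 yx]; rewrite divr_ge0 ?exprn_ge0// subr_ge0; lra.
Qed.

Lemma log_tail_le (R : realType) J (x : R) : 0 <= x < 1 ->
  log_tail J x <= x ^+ J.+1 / (1 - x).
Proof.
move=> /andP[x0 x1]; rewrite -subr_ge0.
pose g (y : R) := y ^+ J.+1 / (1 - y) - log_tail J y.
have -> : 0 = g 0 by rewrite /g log_tail0 expr0n mul0r subr0.
apply: (@nonneg_derive_le R g
  (fun y => y ^+ J * (J%:R * (1 - y) + y) / (1 - y) ^+ 2)) => //.
  move=> y /andP[y0 yx]; have y1 : y < 1 by exact: le_lt_trans x1.
  have y10 : 1 - y != 0 by rewrite gt_eqF// subr_gt0.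
  have h := is_deriveB (is_derive_mulf (is_derive_powS J y) (is_derive_inv1B y1))
                       (is_derive_log_tail J y1).
  apply: (is_derive_eq h); rewrite exprSr -[J.+1]addn1 natrD.
  by move: (y ^+ J) => a; field.
move=> y /andP[y0 yx]; have y1 : 0 < 1 - y by lra.
by rewrite divr_ge0 ?sqr_ge0// mulr_ge0 ?exprn_ge0// addr_ge0// mulr_ge0// ltW.
Qed.

Lemma sum_geometric (R : realType) (q : R) K L : (K <= L)%N -> q != 1 ->
  \sum_(K.+1 <= l < L.+1) q ^+ l = (q ^+ K.+1 - q ^+ L.+1) / (1 - q).
Proof.
move=> KL q1; have q10 : 1 - q != 0 by rewrite subr_eq0 eq_sym.
elim: L KL => [|L IH].
  by rewrite leqn0 => /eqP ->; rewrite big_geq// subrr mul0r.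
rewrite leq_eqVlt => /orP[/eqP ->|KL]; first by rewrite big_geq// subrr mul0r.
rewrite big_nat_recr//= IH// !(exprS q L.+1).
by move: (q ^+ K.+1) (q ^+ L.+1) => a b; field.
Qed.

(** The logarithm of the geometric series 1 + exp (- u) + exp (- 2 u) + ...,
    which sums the weights of all multiplicities of one type. *)
Definition log_geom (R : realType) (u : R) : R := - ln (1 - expR (- u)).

Lemma expRN_lt1 (R : realType) (u : R) : 0 < u -> 0 < expR (- u) < 1.
Proof. by move=> u0; rewrite expR_gt0 -expR0 ltr_expR oppr_lt0. Qed.

Lemma expRN_mul1D (R : realType) (u : R) : expR (- u) * (1 + u) <= 1.
Proof. by rewrite expRN mulrC ler_pdivrMr ?expR_gt0// mul1r expR_ge1Dx. Qed.

Lemma expRN_le_inv (R : realType) (u : R) : 0 < u -> expR (- u) <= u^-1.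
Proof.
move=> u0; rewrite -[u^-1]mul1r ler_pdivlMr//.
by have := expRN_mul1D u; have := expR_gt0 (- u); lra.
Qed.

Lemma log_geom_ge0 (R : realType) (u : R) : 0 < u -> 0 <= log_geom u.
Proof. by move=> /expRN_lt1/andP[q0 q1]; rewrite oppr_ge0 ln_le0//; lra. Qed.

Lemma expRNM_nat (R : realType) (u : R) l : expR (- (u * l%:R)) = expR (- u) ^+ l.
Proof. by rewrite -mulNr expRM_natr. Qed.

Lemma sum_expRN_le (R : realType) (u : R) n : 0 < u ->
  \sum_(1 <= l < n.+1) expR (- u) ^+ l <= u^-1.
Proof.
move=> u0; have /andP[q0 q1] := expRN_lt1 u0.
rewrite sum_geometric ?lt_eqF// expr1 ler_pdivrMr ?subr_gt0// ler_pdivlMl//.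
have := expRN_mul1D u; set q := expR _ in q0 q1 *.
have := mulr_ge0 (ltW u0) (exprn_ge0 n.+1 (ltW q0)); lra.
Qed.

(** Expanding the logarithm and summing over l first leaves
    sum_j 1 / (j (exp (t j) - 1)) <= sum_j 1 / (t j ^ 2). The expansion is cut at
    an order J for which the n remainders add up to at most e. *)
Lemma sum_log_geom_le (R : realType) (t : R) n : 0 < t ->
  \sum_(1 <= l < n.+1) log_geom (t * l%:R) <= pi ^+ 2 / 6 / t.
Proof.
move=> t0; apply/ler_addgt0Pr => e e0.
have := expRN_lt1 t0; set q := expR (- t) => /andP[q0 q1].
have q10 : 0 < 1 - q by rewrite subr_gt0.
pose J := Num.truncn (n%:R / (t * (1 - q) * e)).
have qJ : q ^+ J.+1 / (1 - q) *+ n <= e.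
  have h : q ^+ J.+1 <= (t * J.+1%:R)^-1.
    by rewrite -expRNM_nat expRN_le_inv// mulr_gt0.
  have : n%:R / (t * (1 - q) * e) <= J.+1%:R by exact/ltW/truncnS_gt.
  rewrite ler_pdivrMr ?mulr_gt0// => hn.
  rewrite -mulr_natr; apply: (@le_trans _ _ ((t * J.+1%:R)^-1 / (1 - q) * n%:R)).
    by rewrite !ler_wpM2r// invr_ge0 ltW.
  have J0 : 0 < J.+1%:R :> R by rewrite ltr0n.
  move: h hn J0; move: (J.+1%:R : R) => a _ hn J0.
  have -> : (t * a)^-1 / (1 - q) * n%:R = n%:R / (a * (t * (1 - q))).
    by field; rewrite !gt_eqF.
  rewrite ler_pdivrMr ?mulr_gt0//; apply: (le_trans hn).
  by rewrite le_eqVlt; apply/orP; left; apply/eqP; ring.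
have term l : (0 < l)%N -> log_geom (t * l%:R)
    <= \sum_(1 <= j < J.+1) (q ^+ j) ^+ l / j%:R + q ^+ J.+1 / (1 - q).
  move=> l0; have ql : q ^+ l <= q by rewrite -[leRHS]expr1 ler_wiXn2l ?ltW.
  have ql01 : 0 <= q ^+ l < 1 by rewrite exprn_ge0 ?ltW//= (le_lt_trans ql).
  have := log_tail_le J ql01; rewrite /log_tail lerBlDr [leRHS]addrC => h.
  rewrite /log_geom expRNM_nat; apply: (le_trans h); apply: lerD.
    by apply: ler_sum => j _; rewrite exprAC.
  have /andP[ql0 ql1] := ql01; apply: ler_pM.
  - by rewrite exprn_ge0.
  - by rewrite invr_ge0 subr_ge0 ltW.
  - by apply: lerXn2r => //; rewrite nnegrE ltW.
  - by rewrite lef_pV2 ?posrE ?subr_gt0// lerD2l lerN2.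
apply: (@le_trans _ _ (\sum_(1 <= l < n.+1)
  (\sum_(1 <= j < J.+1) (q ^+ j) ^+ l / j%:R + q ^+ J.+1 / (1 - q)))).
  by rewrite big_nat [leRHS]big_nat; apply: ler_sum => l /andP[l0 _]; exact: term.
rewrite big_split /= sumr_const_nat subn1 /= lerD// exchange_big_nat/=.
apply: (@le_trans _ _ (basel_sum R J / t)); last first.
  by rewrite ler_pM2r ?invr_gt0// basel_upper.
rewrite /basel_sum big_distrl /= big_nat [leRHS]big_nat.
apply: ler_sum => j /andP[j0 _]; have j0' : 0 < j%:R :> R by rewrite ltr0n.
rewrite -big_distrl /= ler_pdivrMr//.
have := @sum_expRN_le R (t * j%:R) n (mulr_gt0 t0 j0').
rewrite expRNM_nat => h; apply: (le_trans h).
by rewrite le_eqVlt; apply/orP; left; apply/eqP; field; rewrite !gt_eqF.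
Qed.

Definition harmonic_sum (R : realType) (n : nat) : R :=
  \sum_(1 <= k < n.+1) k%:R^-1.

Lemma harmonic_sum_le (R : realType) n : (0 < n)%N -> harmonic_sum R n <= 1 + ln n%:R.
Proof.
case: n => // n _; elim: n => [|n IH].
  by rewrite /harmonic_sum big_nat1 ln1 invr1 addr0.
rewrite /harmonic_sum big_nat_recr//=; apply: (le_trans (lerD IH (lexx _))).
rewrite -addrA lerD2l.
have n0 : 0 < n.+1%:R :> R by rewrite ltr0n.
have n1 : 0 < n.+2%:R :> R by rewrite ltr0n.
have -> : n.+1%:R = n.+2%:R * (1 + - n.+2%:R^-1) :> R.
  by rewrite mulrDr mulr1 mulrN divff ?gt_eqF// -[in RHS]natr1 addrK.
rewrite lnM ?posrE//; last first.
  by rewrite subr_gt0 invf_lt1// ltr1n.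
rewrite -addrA gerDl -lerBrDr sub0r; apply: le_ln1Dx.
by rewrite ltrN2 invf_lt1// ltr1n.
Qed.

Lemma harmonic_sum_ge (R : realType) n : ln n.+1%:R <= harmonic_sum R n.
Proof.
elim: n => [|n IH]; first by rewrite ln1 /harmonic_sum big_geq.
rewrite /harmonic_sum big_nat_recr//=; apply: le_trans (lerD IH (lexx _)).
have n0 : 0 < n.+1%:R :> R by rewrite ltr0n.
have -> : n.+2%:R = n.+1%:R * (1 + n.+1%:R^-1) :> R.
  by rewrite mulrDr mulr1 divff ?gt_eqF// natr1.
have i0 : 0 < n.+1%:R^-1 :> R by rewrite invr_gt0.
rewrite lnM ?posrE ?addr_gt0// lerD2l; apply: le_ln1Dx.
exact: lt_trans (ltrN10 R) i0.
Qed.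

(** * Free energy of a family of rectangle types *)

Lemma sum_ord_range (R : realType) a b n (G : nat -> R) : (b <= n)%N ->
  \sum_(l < n | (a <= l < b)%N) G l = \sum_(a <= l < b) G l.
Proof.
move=> bn; rewrite -(big_mkord (fun l => (a <= l < b)%N)).
rewrite (big_nat_widen a b n)// (big_nat_widenl a 0)//.
by apply: eq_bigl => i; rewrite andbC.
Qed.

Lemma sum_tile_type (R : realType) n (P : pred (nat * nat)) (g : nat -> nat -> R) :
  \sum_(t : tile_type n P) g (dims t).1 (dims t).2 =
  \sum_(k < n.+1) \sum_(l < n.+1 | P (nat_of_ord k, nat_of_ord l)) g k l.
Proof.
rewrite pair_big_dep /=.
by rewrite (big_sub [pred t : 'I_n.+1 * 'I_n.+1 | P (val t.1, val t.2)]
  (fun t => g t.1 t.2)).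
Qed.

(** The logarithm of the sum of exp (- s * area) over all multiplicity functions,
    as this sum is a product of geometric series. *)
Definition free_energy (R : realType) n (P : pred (nat * nat)) (s : R) : R :=
  \sum_(t : tile_type n P) log_geom (s * ((dims t).1 * (dims t).2)%:R).

(** Only the leading term pi ^ 2 / 12 * ln n matters for the asymptotics; the
    other terms let [free_energy_oriented] hold without an error term. *)
Definition energy_coef (R : realType) (n : nat) : R :=
  pi ^+ 2 / 12 * (ln n%:R + 1 + pi ^+ 2 / 6).

Lemma sum_symmetric (R : realType) (F : nat -> nat -> R) n :
  (forall k l, F k l = F l k) ->
  (\sum_(1 <= k < n.+1) \sum_(k <= l < n.+1) F k l) *+ 2 =
  \sum_(1 <= k < n.+1) \sum_(1 <= l < n.+1) F k l + \sum_(1 <= k < n.+1) F k k.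
Proof.
move=> FC; elim: n => [|n IH]; first by rewrite !big_geq// mul0rn addr0.
rewrite (big_nat_recr n.+1)//= big_nat1.
have -> : \sum_(1 <= k < n.+1) \sum_(k <= l < n.+2) F k l =
    \sum_(1 <= k < n.+1) \sum_(k <= l < n.+1) F k l + \sum_(1 <= k < n.+1) F k n.+1.
  rewrite -big_split /= big_nat [RHS]big_nat; apply: eq_bigr => k /andP[_ kn].
  by rewrite big_nat_recr//= ltnW.
have -> : \sum_(1 <= k < n.+2) \sum_(1 <= l < n.+2) F k l =
    \sum_(1 <= k < n.+1) \sum_(1 <= l < n.+1) F k l
    + \sum_(1 <= k < n.+1) F k n.+1 + \sum_(1 <= k < n.+1) F k n.+1 + F n.+1 n.+1.
  rewrite big_nat_recr//= [X in _ + X]big_nat_recr//= addrA.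
  rewrite (eq_bigr _ (fun l _ => FC n.+1 l)); congr (_ + _ + _).
  by rewrite -big_split /=; apply: eq_bigr => k _; rewrite big_nat_recr.
rewrite [X in _ = _ + X](big_nat_recr n.+1)//= !mulrnDl {}IH.
by rewrite !mulr2n; ring.
Qed.

(** Twice the sum over k <= l is the sum over all pairs plus the diagonal. Summing
    over l, the former is at most pi ^ 2 / (6 s) times a harmonic sum; the
    diagonal is bounded termwise by the case of a single l and stays of order
    1 / s, because of the convergence of the sum of 1 / k ^ 2. *)
Lemma free_energy_oriented (R : realType) n (s : R) : (0 < n)%N -> 0 < s ->
  free_energy n oriented s <= energy_coef R n / s.
Proof.
move=> n0 s0; pose F k l := log_geom (s * (k * l)%:R).
rewrite /free_energy (@sum_tile_type R n oriented F).
have -> : \sum_(k < n.+1) \sum_(l < n.+1 | oriented (nat_of_ord k, nat_of_ord l)) F k l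
    = \sum_(1 <= k < n.+1) \sum_(k <= l < n.+1) F k l.
  rewrite -(@sum_ord_range R 1 n.+1 n.+1 (fun k => \sum_(k <= l < n.+1) F k l))//.
  rewrite [RHS]big_mkcond; apply: eq_bigr => k _ /=.
  rewrite ltn_ord andbT; case: ifPn => [k0|k0]; last first.
    by rewrite big1// => l; rewrite /oriented /= (negbTE k0).
  rewrite -(@sum_ord_range R k n.+1 n.+1)//; apply: eq_bigl => l.
  by rewrite /oriented /= k0 ltn_ord andbT.
have FC k l : F k l = F l k by rewrite /F mulnC.
have := sum_symmetric n FC; set A := \sum_(1 <= k < n.+1) _; clearbody A => AA.
have c0 : 0 <= pi ^+ 2 / 6 :> R by rewrite divr_ge0// sqr_ge0.
have full : \sum_(1 <= k < n.+1) \sum_(1 <= l < n.+1) F k l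
    <= pi ^+ 2 / 6 / s * (1 + ln n%:R).
  apply: (@le_trans _ _ (pi ^+ 2 / 6 / s * harmonic_sum R n)); last first.
    by rewrite ler_wpM2l ?harmonic_sum_le// divr_ge0// ltW.
  rewrite /harmonic_sum big_distrr /= big_nat [leRHS]big_nat.
  apply: ler_sum => k /andP[k0 _]; have k0' : 0 < k%:R :> R by rewrite ltr0n.
  have := sum_log_geom_le n (mulr_gt0 s0 k0'); rewrite invfM mulrA.
  apply: le_trans; rewrite le_eqVlt; apply/orP; left; apply/eqP.
  by apply: eq_bigr => l _; rewrite /F natrM mulrA.
have diag : \sum_(1 <= k < n.+1) F k k <= pi ^+ 2 / 6 / s * (pi ^+ 2 / 6).
  apply: (@le_trans _ _ (pi ^+ 2 / 6 / s * basel_sum R n)); last first.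
    by rewrite ler_wpM2l ?basel_upper// divr_ge0// ltW.
  rewrite /basel_sum big_distrr /= big_nat [leRHS]big_nat.
  apply: ler_sum => k /andP[k0 _]; have k0' : 0 < k%:R :> R by rewrite ltr0n.
  have k2 : 0 < k%:R ^+ 2 :> R by rewrite exprn_gt0.
  have := sum_log_geom_le 1 (mulr_gt0 s0 k2).
  by rewrite big_nat1 mulr1 invfM [leRHS]mulrA /F natrM -expr2.
have -> : energy_coef R n / s =
    (pi ^+ 2 / 6 / s * (1 + ln n%:R) + pi ^+ 2 / 6 / s * (pi ^+ 2 / 6)) / 2.
  rewrite /energy_coef; move: (pi ^+ 2) (ln n%:R) => a b; field; by rewrite gt_eqF.
by rewrite ler_pdivlMr// mulr_natr AA lerD.
Qed.

Lemma free_energy_subset (R : realType) n (P Q : pred (nat * nat)) (s : R) :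
  0 < s -> (forall q, P q -> Q q) -> (forall q, Q q -> 0 < q.1 * q.2)%N ->
  free_energy n P s <= free_energy n Q s.
Proof.
move=> s0 PQ Q0; pose F k l := log_geom (s * (k * l)%:R).
rewrite /free_energy (@sum_tile_type R n P F) (@sum_tile_type R n Q F).
apply: ler_sum => k _; rewrite big_mkcond [leRHS]big_mkcond; apply: ler_sum => l _.
have [Pkl|_] := boolP (P _); first by rewrite PQ.
case: ifP => // /Q0 /= kl0; apply: log_geom_ge0.
by rewrite mulr_gt0// ltr0n.
Qed.

(** The logarithms are cut at order J. For u = s k j, the geometric progression
    exp (- u l) over K < l <= L is at least (1 - rho) / u, because u (K + 1) is
    small and u (L + 1) is large; rho bounds the two errors uniformly in k and j. *)
Lemma free_energy_narrow_ge (R : realType) n K L J (s rho : R) :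
  (K <= L)%N -> (L <= n)%N -> 0 < s ->
  s * (K * J)%:R * K.+1%:R + (s * L.+1%:R)^-1 <= rho ->
  (1 - rho) / s * harmonic_sum R K * basel_sum R J <= free_energy n (narrow K L) s.
Proof.
move=> KL Ln s0 hrho; pose F k l := log_geom (s * (k * l)%:R).
rewrite /free_energy (@sum_tile_type R n (narrow K L) F).
have -> : \sum_(k < n.+1)
      \sum_(l < n.+1 | narrow K L (nat_of_ord k, nat_of_ord l)) F k l
    = \sum_(1 <= k < K.+1) \sum_(K.+1 <= l < L.+1) F k l.
  rewrite -(@sum_ord_range R 1 K.+1 n.+1 (fun k => \sum_(K.+1 <= l < L.+1) F k l));
    last by rewrite ltnS (leq_trans KL).
  rewrite [RHS]big_mkcond; apply: eq_bigr => k _ /=.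
  rewrite !ltnS; case: ifPn => [k0|k0]; last first.
    by rewrite big1// => l; rewrite /narrow /= (negbTE k0).
  rewrite -(@sum_ord_range R K.+1 L.+1 n.+1)//; apply: eq_bigl => l.
  by rewrite /narrow /= k0 ltnS.
rewrite /harmonic_sum mulrAC big_distrr /= big_nat [leRHS]big_nat.
apply: ler_sum => k /andP[k0 kK]; have k0' : 0 < k%:R :> R by rewrite ltr0n.
apply: (@le_trans _ _ (\sum_(K.+1 <= l < L.+1) \sum_(1 <= j < J.+1)
  expR (- (s * k%:R * j%:R)) ^+ l / j%:R)); last first.
  rewrite [leLHS]big_nat [leRHS]big_nat; apply: ler_sum => l /andP[Kl _].
  have l0 : 0 < l%:R :> R by rewrite ltr0n; lia.
  have skl : 0 < s * (k * l)%:R by rewrite natrM !mulr_gt0.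
  have /andP[q0 q1] := expRN_lt1 skl.
  have := @log_tail_ge0 R J (expR (- (s * (k * l)%:R))).
  rewrite q1 ltW// /log_tail subr_ge0 -/(log_geom _) -/(F k l) => /(_ isT).
  apply: le_trans; apply: ler_sum => j _; rewrite -!expRNM_nat natrM.
  by rewrite le_eqVlt; apply/orP; left; apply/eqP; congr (expR (- _) / _); ring.
rewrite exchange_big_nat /= /basel_sum big_distrr big_distrl /=.
rewrite [leLHS]big_nat [leRHS]big_nat; apply: ler_sum => j /andP[j0 jJ].
have j0' : 0 < j%:R :> R by rewrite ltr0n.
rewrite -big_distrl /= ler_pdivlMr//.
set u := s * k%:R * j%:R; have u0 : 0 < u by rewrite !mulr_gt0.
have /andP[q0 q1] := expRN_lt1 u0.
rewrite sum_geometric ?lt_eqF//.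
have q10 : 0 < 1 - expR (- u) by rewrite subr_gt0.
have qu : 1 - expR (- u) <= u by have := expR_ge1Dx (- u); lra.
have -> : (1 - rho) / s * (j%:R ^+ 2)^-1 / k%:R * j%:R = (1 - rho) / u.
  by rewrite /u; field; rewrite !gt_eqF.
have hk : 1 - u * K.+1%:R <= expR (- u) ^+ K.+1.
  by rewrite -expRNM_nat; have := expR_ge1Dx (- (u * K.+1%:R)); lra.
have L0 : 0 < L.+1%:R :> R by rewrite ltr0n.
have K0 : 0 < K.+1%:R :> R by rewrite ltr0n.
have hl : expR (- u) ^+ L.+1 <= (s * L.+1%:R)^-1.
  rewrite -expRNM_nat; apply: (@le_trans _ _ (u * L.+1%:R)^-1).
    by rewrite expRN_le_inv// mulr_gt0.
  rewrite lef_pV2 ?posrE ?mulr_gt0// ler_pM2r// /u -mulrA -natrM.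
  by rewrite ler_peMr ?(ltW s0)// ler1n muln_gt0 k0.
have huK : u * K.+1%:R <= s * (K * J)%:R * K.+1%:R.
  rewrite ler_pM2r// /u -mulrA -natrM ler_pM2l// ler_nat.
  by rewrite leq_mul.
apply: (@le_trans _ _ ((expR (- u) ^+ K.+1 - expR (- u) ^+ L.+1) / u)).
  rewrite ler_pM2r ?invr_gt0//; apply: le_trans (lerB hk hl).
  by rewrite -addrA -opprD lerD2l lerN2 (le_trans _ hrho)// lerD2r.
apply: ler_wpM2l; last by rewrite lef_pV2 ?posrE.
by rewrite subr_ge0 ler_wiXn2l ?ltW.
Qed.

(** * Counting by exponential tilting *)

(** Distributivity: a multiplicity function chooses one term in the geometric
    progression of each type. *)
Lemma boltzmann_prod (R : realType) (T : finType) (w : T -> nat) B (s : R) :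
  \sum_(f : {ffun T -> 'I_B.+1}) expR (- (s * (\sum_t f t * w t)%N%:R)) =
  \prod_t \sum_(i < B.+1) expR (- (s * (w t)%:R)) ^+ i.
Proof.
rewrite bigA_distr_bigA; apply: eq_bigr => f _.
rewrite natr_sum mulr_sumr -sumrN expR_sum; apply: eq_bigr => t _.
by rewrite -expRNM_nat natrM; congr (expR (- _)); ring.
Qed.

Lemma geometric_expR (R : realType) (u : R) B : 0 < u ->
  \sum_(i < B.+1) expR (- u) ^+ i =
  (1 - expR (- u) ^+ B.+1) * expR (log_geom u).
Proof.
move=> u0; have /andP[q0 q1] := expRN_lt1 u0.
have q10 : 0 < 1 - expR (- u) by rewrite subr_gt0.
rewrite /log_geom [expR (- ln _)]expRN lnK ?posrE//.
apply: (mulIf (lt0r_neq0 q10)); rewrite mulfVK ?gt_eqF//.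
rewrite mulrC; have := subrX1 (expR (- u)) B.+1.
by move: (\sum_(i < B.+1) _) (expR (- u) ^+ B.+1) => a b; lra.
Qed.

Lemma boltzmann_le (R : realType) (T : finType) (w : T -> nat) B (s : R) :
  (forall t, 0 < w t)%N -> 0 < s ->
  \sum_(f : {ffun T -> 'I_B.+1}) expR (- (s * (\sum_t f t * w t)%N%:R))
  <= expR (\sum_t log_geom (s * (w t)%:R)).
Proof.
move=> w0 s0; rewrite boltzmann_prod expR_sum; apply: ler_prod => t _.
have sw : 0 < s * (w t)%:R by rewrite mulr_gt0// ltr0n.
have /andP[q0 q1] := expRN_lt1 sw; apply/andP; split.
  by apply: sumr_ge0 => i _; rewrite exprn_ge0 ?ltW.
by rewrite geometric_expR// ler_piMl ?expR_ge0// gerDl oppr_le0 exprn_ge0 ?ltW.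
Qed.

Lemma weierstrass_prod (R : realFieldType) (T : finType) (x : T -> R) :
  (forall t, 0 <= x t <= 1) -> 1 - \sum_t x t <= \prod_t (1 - x t).
Proof.
move=> x01.
suff : [/\ 0 <= \prod_t (1 - x t), 0 <= \sum_t x t
    & 1 - \sum_t x t <= \prod_t (1 - x t)] by case.
apply: (big_rec2 (fun p q => [/\ 0 <= p, 0 <= q & 1 - q <= p])).
  by split=> //; rewrite subr0.
move=> t p q _ [p0 q0 pq]; have /andP[a b] := x01 t.
split; [by rewrite mulr_ge0// subr_ge0 | by rewrite addr_ge0 | nra].
Qed.

(** Cutting the geometric series after exponent B costs the factor
    1 - exp (- s w) ^ (B + 1) for each type, and the product of these factors
    tends to 1. *)
Lemma boltzmann_ge (R : realType) (T : finType) (w : T -> nat) (s : R) :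
  (forall t, 0 < w t)%N -> 0 < s ->
  exists B, expR (\sum_t log_geom (s * (w t)%:R)) <=
   2 * \sum_(f : {ffun T -> 'I_B.+1}) expR (- (s * (\sum_t f t * w t)%N%:R)).
Proof.
move=> w0 s0; pose B := Num.truncn (2 * #|T|%:R / s).
exists B; rewrite boltzmann_prod expR_sum.
have sw t : 0 < s * (w t)%:R by rewrite mulr_gt0// ltr0n.
have -> : \prod_t \sum_(i < B.+1) expR (- (s * (w t)%:R)) ^+ i =
    \prod_t ((1 - expR (- (s * (w t)%:R)) ^+ B.+1) * expR (log_geom (s * (w t)%:R))).
  by apply: eq_bigr => t _; rewrite geometric_expR.
rewrite big_split /= mulrA ler_peMl//.
  by apply: prodr_ge0 => t _; exact: expR_ge0.
have sB : 0 < s * B.+1%:R by rewrite mulr_gt0.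
have q_le t : expR (- (s * (w t)%:R)) ^+ B.+1 <= (s * B.+1%:R)^-1.
  apply: le_trans (expRN_le_inv sB); rewrite -expRNM_nat ler_expR lerN2.
  by rewrite -mulrA ler_pM2l// -natrM ler_nat leq_pmull.
have h := @weierstrass_prod R T (fun t => expR (- (s * (w t)%:R)) ^+ B.+1).
have {}h := h _; have /h : forall t, 0 <= expR (- (s * (w t)%:R)) ^+ B.+1 <= 1.
  move=> t; have /andP[q0 q1] := expRN_lt1 (sw t).
  by rewrite exprn_ge0 ?exprn_ile1 ?ltW.
have : \sum_t expR (- (s * (w t)%:R)) ^+ B.+1 <= 2^-1.
  apply: (@le_trans _ _ (\sum_(t : T) (s * B.+1%:R)^-1)); first exact: ler_sum.
  have hB : 2 * #|T|%:R / s <= B.+1%:R by exact/ltW/truncnS_gt.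
  rewrite ler_pdivrMr// in hB.
  rewrite sumr_const (eq_card (B := T))// -[leLHS]mulr_natr [leLHS]mulrC.
  rewrite ler_pdivrMr// ler_pdivlMl//.
  by rewrite [leRHS]mulrC.
move: (\sum_t _) (\prod_t _) => a b; lra.
Qed.

(** The sum of exp (- s a) is concentrated on values of a near L / s ^ 2. Indeed
    values above (1 + d) L / s ^ 2 are controlled by the sum at (1 - h) s, values
    below (1 - d) L / s ^ 2 by the sum at (1 + h) s, and for h = d / 4 both
    contributions are smaller than the whole by a factor of order
    exp (d ^ 2 / 16 * L / s).
    Each of the remaining elements has weight at most exp (- (1 - d) L / s), so
    there must be many of them. *)
Lemma tilted_count (R : realType) (Om : finType) (a : Om -> R) (L s d : R) :
  0 < s -> 0 < L -> 0 < d <= 1 ->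
  (forall r, 0 < r -> \sum_x expR (- (r * a x)) <= expR (L / r)) ->
  expR ((1 - d ^+ 2 / 16) * (L / s)) <= 2 * \sum_x expR (- (s * a x)) ->
  8 <= expR (d ^+ 2 / 16 * (L / s)) ->
  expR ((2 - 2 * d) * (L / s)) <= #|[pred x | a x <= (1 + d) * L / s ^+ 2]|%:R.
Proof.
move=> s0 L0 /andP[d0 d1] hup hlo hbig.
set c := L / s in hlo hbig *; have c0 : 0 < c by rewrite divr_gt0.
set X := (1 + d) * L / s ^+ 2; pose Y := (1 - d) * L / s ^+ 2.
pose h := d / 4; set N := #|_|%:R.
have h0 : 0 < h by rewrite divr_gt0.
have h1 : h <= 1 / 4 by rewrite /h; lra.
have sY : s * Y = (1 - d) * c by rewrite /Y /c; field; rewrite gt_eqF.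
have sX : s * X = (1 + d) * c by rewrite /X /c; field; rewrite gt_eqF.
have pointwise x : expR (- (s * a x)) <= (a x <= X)%R%:R * expR (- (s * Y))
    + expR (h * (s * Y)) * expR (- ((1 + h) * s * a x))
    + expR (- (h * (s * X))) * expR (- ((1 - h) * s * a x)).
  rewrite -!expRD; have [aX|Xa] := leP (a x) X; last first.
    rewrite mul0r add0r -[leLHS]add0r; apply: lerD; first exact: expR_ge0.
    rewrite ler_expR.
    have : 0 <= h * s * (a x - X) by rewrite !mulr_ge0 ?ltW ?subr_gt0.
    by lra.
  rewrite mul1r; have [aY|Ya] := leP Y (a x).
    rewrite -[leLHS]addr0; apply: lerD; last exact: expR_ge0.
    rewrite -[leLHS]addr0; apply: lerD; last exact: expR_ge0.
    by rewrite ler_expR lerN2 ler_pM2l.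
  rewrite -[leLHS]addr0; apply: lerD; last exact: expR_ge0.
  rewrite -[leLHS]add0r; apply: lerD; first exact: expR_ge0.
  rewrite ler_expR.
  have : 0 <= h * s * (Y - a x) by rewrite !mulr_ge0 ?ltW ?subr_gt0.
  by lra.
have total : \sum_x expR (- (s * a x)) <= N * expR (- (s * Y))
    + expR (h * (s * Y)) * expR (L / ((1 + h) * s))
    + expR (- (h * (s * X))) * expR (L / ((1 - h) * s)).
  apply: (le_trans (ler_sum _ (fun x _ => pointwise x))).
  rewrite !big_split /= -!mulr_sumr -mulr_suml.
  have -> : \sum_x (a x <= X)%R%:R = N.
    rewrite /N -sum1_card natr_sum [RHS]big_mkcond; apply: eq_bigr => x _.
    by rewrite inE; case: ifP.
  by rewrite !lerD// ler_wpM2l ?expR_ge0// hup// mulr_gt0//; lra.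
pose E := expR ((1 - d ^+ 2 / 8) * c).
have lo : expR (h * (s * Y)) * expR (L / ((1 + h) * s)) <= E.
  rewrite -expRD ler_expR sY.
  have -> : L / ((1 + h) * s) = (1 + h)^-1 * c.
    by rewrite /c; field; rewrite !gt_eqF//; lra.
  rewrite mulrA -mulrDl ler_pM2r//.
  have : (1 + h)^-1 <= 1 - h + h ^+ 2.
    rewrite -[leLHS]mul1r ler_pdivrMr; [|lra].
    have : 0 <= h ^+ 3 by rewrite exprn_ge0 ?ltW.
    by lra.
  by rewrite /h; nra.
have hi : expR (- (h * (s * X))) * expR (L / ((1 - h) * s)) <= E.
  rewrite -expRD ler_expR sX.
  have -> : L / ((1 - h) * s) = (1 - h)^-1 * c.
    by rewrite /c; field; rewrite !gt_eqF//; lra.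
  rewrite mulrA -mulNr -mulrDl ler_pM2r//.
  have : (1 - h)^-1 <= 1 + h + 4 / 3 * h ^+ 2.
    rewrite -[leLHS]mul1r ler_pdivrMr; [|lra].
    have : 0 <= h ^+ 2 * (1 / 4 - h) by rewrite mulr_ge0 ?sqr_ge0 ?subr_ge0.
    by lra.
  by rewrite /h; nra.
have E0 : 0 < E by exact: expR_gt0.
have e8 : 8 * E <= expR ((1 - d ^+ 2 / 16) * c).
  have -> : (1 - d ^+ 2 / 16) * c = d ^+ 2 / 16 * c + (1 - d ^+ 2 / 8) * c by field.
  by rewrite expRD ler_pM2r.
have NE : E <= N * expR (- (s * Y)) by lra.
have -> : (2 - 2 * d) * c = (1 - d) * c + (1 - d) * c by ring.
apply: (@le_trans _ _ (E * expR (s * Y))).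
  rewrite -expRD ler_expR sY lerD2r ler_pM2r//; nra.
by rewrite -ler_pdivlMr ?expR_gt0// -expRN.
Qed.

(** * Bounds on the number of partitions *)

Definition tile_area n P (t : tile_type n P) : nat := ((dims t).1 * (dims t).2)%N.

Lemma energy_coef_gt0 (R : realType) n : (0 < n)%N -> 0 < energy_coef R n.
Proof.
move=> n0; have p0 : 0 < pi ^+ 2 :> R by rewrite exprn_gt0 ?pi_gt0.
have l0 : 0 <= ln n%:R :> R by rewrite ln_ge0// ler1n.
rewrite /energy_coef mulr_gt0 ?divr_gt0//.
have : 0 < pi ^+ 2 / 6 :> R by rewrite divr_gt0.
by move: (ln _) (_ / _) l0 => a b; lra.
Qed.

Lemma oriented_gt0 q : oriented q -> (0 < q.1 * q.2)%N.
Proof. by rewrite /oriented muln_gt0; lia. Qed.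

Lemma boltzmann_family_le (R : realType) n (P : pred (nat * nat)) B (s : R) :
  (forall q, P q -> oriented q) -> (0 < n)%N -> 0 < s ->
  \sum_(m : {ffun tile_type n P -> 'I_B.+1}) expR (- (s * (total_area m)%:R))
  <= expR (energy_coef R n / s).
Proof.
move=> Po n0 s0.
apply: (le_trans (@boltzmann_le R (tile_type n P) (@tile_area n P) B s _ s0)).
  by move=> t; apply: oriented_gt0; apply: Po; exact: dimsP.
rewrite ler_expR; apply: le_trans (free_energy_oriented n0 s0).
exact: (free_energy_subset n s0 Po oriented_gt0).
Qed.

(** The value s = sqrt Lambda / n minimizes s n ^ 2 + Lambda / s. *)
Lemma num_partitions_upper (R : realType) n : (0 < n)%N ->
  (num_partitions R n n)%:R <= expR (2 * n%:R * Num.sqrt (energy_coef R n)) :> R.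
Proof.
move=> n0; have L0 := energy_coef_gt0 R n0.
have N0 : 0 < n%:R :> R by rewrite ltr0n.
set rt := Num.sqrt (energy_coef R n); have rt0 : 0 < rt by rewrite sqrtr_gt0.
have rt2 : rt ^+ 2 = energy_coef R n by rewrite sqr_sqrtr// ltW.
pose s := rt / n%:R; have s0 : 0 < s by rewrite divr_gt0.
have e2 : 2 * n%:R * rt = s * (n * n)%:R + energy_coef R n / s.
  by rewrite -rt2 /s natrM; field; rewrite !gt_eqF.
apply: (@le_trans _ _ (#|[pred m : {ffun tile_type n oriented -> 'I_(n * n).+1} |
   (total_area m <= n * n)%N]|%:R)); first by rewrite ler_nat num_partitions_le.
rewrite e2 expRD.
apply: le_trans (ler_wpM2l (expR_ge0 _)
  (@boltzmann_family_le R n oriented (n * n) s (fun _ => id) n0 s0)).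
rewrite mulr_sumr -sum1_card natr_sum big_mkcond /=; apply: ler_sum => m _.
rewrite inE -expRD; case: ifPn => [hm|_]; last exact: expR_ge0.
rewrite -[leLHS]expR0 ler_expR -mulrBr mulr_ge0 ?(ltW s0)// subr_ge0.
by rewrite ler_nat.
Qed.

(** The hypothesis on s says that the areas that carry most of the weight are at
    most (1 - d) ^ 2 n ^ 2, which leaves enough room for the packing. *)
Lemma num_partitions_tilted (R : realType) n K L (d s : R) :
  0 < d <= 1 -> (0 < K <= L)%N -> (L < n)%N -> 0 < s ->
  (L%:R <= d * n%:R) -> ((K * K)%:R <= d * n%:R) ->
  (1 + d) * energy_coef R n / s ^+ 2 <= (1 - d) ^+ 2 * n%:R ^+ 2 ->
  (1 - d ^+ 2 / 16) * (energy_coef R n / s) <= free_energy n (narrow K L) s ->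
  8 <= expR (d ^+ 2 / 16 * (energy_coef R n / s)) ->
  expR ((2 - 2 * d) * (energy_coef R n / s)) <= (num_partitions R n n)%:R.
Proof.
move=> d01 /andP[K0 KL] Ln s0 hL hK hs hf hbig.
have n0 : (0 < n)%N by lia.
have narrow_or q : narrow K L q -> oriented q by rewrite /narrow /oriented; lia.
have [B hB] := @boltzmann_ge R (tile_type n (narrow K L)) (@tile_area n (narrow K L)) s
  (fun t => oriented_gt0 (narrow_or _ (dimsP t))) s0.
have hup r : 0 < r -> \sum_(m : {ffun tile_type n (narrow K L) -> 'I_B.+1})
    expR (- (r * (total_area m)%:R)) <= expR (energy_coef R n / r).
  by move=> r0; apply: boltzmann_family_le.
have hlo : expR ((1 - d ^+ 2 / 16) * (energy_coef R n / s)) <=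
    2 * \sum_(m : {ffun tile_type n (narrow K L) -> 'I_B.+1})
    expR (- (s * (total_area m)%:R)).
  by apply: le_trans hB; rewrite ler_expR.
apply: (le_trans (tilted_count s0 (energy_coef_gt0 R n0) d01 hup hlo hbig)).
rewrite ler_nat; apply: leq_trans (num_partitions_ge R B K0 Ln).
apply: subset_leq_card; apply/fintype.subsetP => m; rewrite !inE => hm.
have : (total_area m)%:R <= (1 - d) ^+ 2 * n%:R ^+ 2 :> R by apply: le_trans hs.
have /andP[d0 d1] := d01.
have Ln' : (L <= n)%N := ltnW Ln.
move=> ha; rewrite -(ler_nat R) natrD !natrM natrB//; move: ha hL hK.
rewrite natrM; have N0 := ler0n R n.
move: (n%:R : R) ((total_area m)%:R : R) (L%:R : R) (K%:R * K%:R : R) N0.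
move=> N a l k N0 ha hl hk.
have h : 0 <= (N - l - (1 - d) * N) * (N - k).
  by rewrite mulr_ge0//; [lra | nra].
have h' : 0 <= (1 - d) * N * (N - k - (1 - d) * N).
  by rewrite !mulr_ge0//; lra.
nra.
Qed.

(** From exp (- u / 2) <= 2 / u, squared: any decay faster than 1 / y would do. *)
Lemma expRN_mul_le (R : realType) (e y : R) : 0 < e -> 0 < y ->
  expR (- (e * y)) * y <= 4 / (e ^+ 2 * y).
Proof.
move=> e0 y0; have ey0 : 0 < e * y / 2 by rewrite divr_gt0// mulr_gt0.
have -> : expR (- (e * y)) = expR (- (e * y / 2)) ^+ 2.
  by rewrite -expRNM_nat; congr expR; field.
have -> : 4 / (e ^+ 2 * y) = (e * y / 2)^-1 ^+ 2 * y by field; rewrite !gt_eqF.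
rewrite ler_pM2r//; apply: lerXn2r; last exact: expRN_le_inv.
  by rewrite nnegrE expR_ge0.
by rewrite nnegrE invr_ge0 ltW.
Qed.

(** The hypotheses say that s is sqrt Lambda / n up to a factor 3, that K ^ 2 is
    smaller than n by the factor z, and that L is at least d n. The first error
    then has order J sqrt Lambda z, the second 1 / (sqrt Lambda d). *)
Lemma narrow_error_le (R : realType) (n K L J : nat) (s rt z d e : R) :
  (0 < n)%N -> (0 < K)%N -> 0 < s -> 0 < rt -> 0 < d -> 0 < e ->
  rt / n%:R <= s <= 3 * rt / n%:R -> K%:R * K%:R <= n%:R * z ->
  12 * J%:R * rt * z <= e -> 2 / (e * d) <= rt -> d * n%:R < L.+1%:R ->
  s * (K * J)%:R * K.+1%:R + (s * L.+1%:R)^-1 <= e.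
Proof.
move=> n0 K0 s0 rt0 d0 e0 /andP[s1 s2] hK hJ hrt hL.
have N0 : 0 < n%:R :> R by rewrite ltr0n.
have h1 : s * (K * J)%:R * K.+1%:R <= 6 * J%:R * rt * z.
  have -> : s * (K * J)%:R * K.+1%:R = s * J%:R * (K%:R * K.+1%:R).
    by rewrite natrM; ring.
  have -> : 6 * J%:R * rt * z = 3 * rt / n%:R * J%:R * (2 * (n%:R * z)).
    by field; rewrite gt_eqF.
  apply: ler_pM.
  - by rewrite mulr_ge0// ltW.
  - by rewrite mulr_ge0.
  - by rewrite ler_wpM2r.
  - have k1 : 1 <= K%:R :> R by rewrite ler1n.
    by rewrite -natr1; nra.
have h2 : (s * L.+1%:R)^-1 <= e / 2.
  have sL : rt * d <= s * L.+1%:R.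
    apply: (@le_trans _ _ (s * (d * n%:R))); last by rewrite ler_pM2l// ltW.
    have -> : rt * d = rt / n%:R * (d * n%:R) by field; rewrite gt_eqF.
    by rewrite ler_wpM2r// mulr_ge0// ltW.
  have sL0 : 0 < s * L.+1%:R by rewrite mulr_gt0.
  have -> : e / 2 = (2 / e)^-1 by rewrite invf_div.
  rewrite lef_pV2 ?posrE//; last by rewrite divr_gt0.
  apply: le_trans sL.
  have -> : 2 / e = 2 / (e * d) * d by field; rewrite !gt_eqF.
  by rewrite ler_pM2r.
by apply: (le_trans (lerD h1 h2)); lra.
Qed.

(** Three factors 1 - e are lost: one on the geometric progressions, one on the
    harmonic sum, one on the sum of 1 / j ^ 2. The remaining loss, up to 1 - 6 e,
    absorbs the lower order terms of the coefficient. *)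
Lemma free_energy_narrow_near (R : realType) (n K L J : nat) (s e : R) :
  (K <= L)%N -> (L <= n)%N -> 0 < s -> 0 < e <= 1 / 2 ->
  s * (K * J)%:R * K.+1%:R + (s * L.+1%:R)^-1 <= e ->
  (1 - e) * (pi ^+ 2 / 6) <= basel_sum R J ->
  (1 - e) / 2 * ln n%:R <= ln K.+1%:R ->
  0 <= ln n%:R :> R -> 1 + pi ^+ 2 / 6 <= 3 * e * ln n%:R ->
  (1 - 6 * e) * (energy_coef R n / s) <= free_energy n (narrow K L) s.
Proof.
move=> KL Ln s0 /andP[e0 e1] err hJ hK y0 yD.
apply: le_trans (free_energy_narrow_ge KL Ln s0 err).
rewrite -(mulrAC _ (harmonic_sum _ _)) -[leRHS]mulrAC mulrA ler_pM2r ?invr_gt0//.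
have {}hK := le_trans hK (harmonic_sum_ge R K).
rewrite /energy_coef -[ln _ + 1 + _]addrA.
have e1' : 0 <= 1 - e by lra.
have P0 : 0 <= pi ^+ 2 :> R by exact: sqr_ge0.
move: (ln n%:R : R) (pi ^+ 2 : R) P0 y0 yD hJ hK => y P P0 y0 yD hJ hK.
apply: (@le_trans _ _ ((1 - e) * ((1 - e) / 2 * y) * ((1 - e) * (P / 6)))); last first.
  apply: ler_pM => //.
  - by rewrite !mulr_ge0.
  - by rewrite mulr_ge0// divr_ge0.
  - by rewrite ler_wpM2l.
have -> : (1 - e) * ((1 - e) / 2 * y) * ((1 - e) * (P / 6)) =
   P / 12 * ((1 - e) ^+ 3 * y) by field.
rewrite mulrCA ler_wpM2l ?divr_ge0//.
have D0 : 0 <= 1 + P / 6 by rewrite addr_ge0// divr_ge0.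
have : 0 <= e * (1 + P / 6) by rewrite mulr_ge0// ltW.
have : 0 <= e ^+ 2 * (3 - e) * y.
  by rewrite mulr_ge0// mulr_ge0 ?sqr_ge0//; lra.
by move: (1 + P / 6) yD => D yD; lra.
Qed.

(** With K = n ^ ((1 - e) / 2) the harmonic sum up to K is still about
    (1 - e) / 2 * ln n, while K ^ 2 / n = n ^ (- e) is small. The other parameters
    are L = d n and s = sqrt Lambda / n, enlarged by the factor
    (1 + d) / (1 - d) to keep the area below (1 - d) ^ 2 n ^ 2. *)
Lemma num_partitions_lower_at (R : realType) (d e : R) (J n : nat) :
  0 < d <= 1 / 2 -> 6 * e = d ^+ 2 / 16 -> (0 < n)%N ->
  (1 - e) * (pi ^+ 2 / 6) <= basel_sum R J ->
  expR (- (e * ln n%:R)) <= d ->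
  12 * J%:R * Num.sqrt (energy_coef R n) * expR (- (e * ln n%:R)) <= e ->
  2 / (e * d) <= Num.sqrt (energy_coef R n) ->
  16 * 24 / d ^+ 2 <= Num.sqrt (energy_coef R n) ->
  1 + pi ^+ 2 / 6 <= 3 * e * ln n%:R ->
  expR (2 * (1 - d) ^+ 3 * (n%:R * Num.sqrt (energy_coef R n))) <=
  (num_partitions R n n)%:R.
Proof.
move=> /andP[d0 dh] e6 n0 hJ zd rtz rt_e rt_d yD.
have e0 : 0 < e by have : 0 < d ^+ 2 by [rewrite exprn_gt0]; lra.
have e1 : 0 < e <= 1 / 2 by rewrite e0 /=; nra.
have N0 : 0 < n%:R :> R by rewrite ltr0n.
have N1 : 1 <= n%:R :> R by rewrite ler1n.
have y0 : 0 <= ln n%:R :> R by rewrite ln_ge0.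
have Lam0 := energy_coef_gt0 R n0.
set rt := Num.sqrt (energy_coef R n) in rtz rt_e rt_d *.
have rt0 : 0 < rt by rewrite sqrtr_gt0.
have rt2 : energy_coef R n = rt ^+ 2 by rewrite sqr_sqrtr// ltW.
clearbody rt.
(* K is chosen below so that K ^ 2 is at most n * z. *)
set z := expR (- (e * ln n%:R)) in zd rtz.
pose x := expR ((1 - e) / 2 * ln n%:R).
have x2 : x * x = n%:R * z.
  by rewrite -[n%:R]lnK// /x /z -!expRD; congr expR; field.
have x1 : 1 <= x by rewrite -[leLHS]expR0 ler_expR mulr_ge0// divr_ge0//; lra.
pose K := Num.truncn x; pose L := Num.truncn (d * n%:R).
have Kx : K%:R <= x by rewrite truncn_le (le_trans _ x1).
have xK : x < K.+1%:R by exact: truncnS_gt.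
have K0 : (0 < K)%N by rewrite truncn_gt0.
have dn0 : 0 <= d * n%:R by rewrite mulr_ge0// ltW.
have Ld : L%:R <= d * n%:R by rewrite truncn_le.
have dL : d * n%:R < L.+1%:R by exact: truncnS_gt.
have KK : K%:R * K%:R <= n%:R * z :> R by rewrite -x2 ler_pM.
have KKd : (K * K)%:R <= d * n%:R :> R.
  by rewrite natrM (le_trans KK)// mulrC ler_pM2r.
have KL : (K <= L)%N.
  by rewrite truncn_ge_nat//; apply: le_trans KKd; rewrite ler_nat leq_pmulr.
have Ln : (L < n)%N.
  by rewrite -(ltr_nat R) (le_lt_trans Ld)// gtr_pMl// (le_lt_trans dh)//; lra.
pose kap := (1 + d) / (1 - d).
have d'0 : 0 < 1 - d by rewrite subr_gt0; lra.
have d''0 : 0 < 1 + d by rewrite addr_gt0.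
have kap0 : 0 < kap by rewrite divr_gt0.
have kap1 : 1 <= kap by rewrite ler_pdivlMr// mul1r lerD2l; lra.
have kap3 : kap <= 3 by rewrite ler_pdivrMr//; lra.
pose s := rt * kap / n%:R.
have s0 : 0 < s by rewrite divr_gt0// mulr_gt0.
have s_itv : rt / n%:R <= s <= 3 * rt / n%:R.
  rewrite !ler_pM2r ?invr_gt0// [3 * _]mulrC ler_pM2l// kap3 andbT.
  by rewrite ler_peMr// ltW.
have cE : energy_coef R n / s = rt * n%:R / kap.
  by rewrite rt2 /s; field; rewrite !gt_eqF.
have err := narrow_error_le n0 K0 s0 rt0 d0 e0 s_itv KK rtz rt_e dL.
have en := free_energy_narrow_near KL (ltnW Ln) s0 e1 err hJ.
have d1 : 0 < d <= 1 by rewrite d0 (le_trans dh)//; lra.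
apply: le_trans (@num_partitions_tilted R n K L d s d1 _ Ln s0 Ld KKd _ _ _).
- rewrite ler_expR cE.
  have -> : 2 * (1 - d) ^+ 3 * (n%:R * rt) =
    (2 - 2 * d) * (rt * n%:R * (1 - d) ^+ 2) by ring.
  have -> : 2 - 2 * d = 2 * (1 - d) by ring.
  rewrite ler_pM2l; last by rewrite mulr_gt0.
  rewrite ler_pM2l ?mulr_gt0// /kap invf_div ler_pdivlMr//.
  have : 0 <= (1 - d) * d ^+ 2 by rewrite mulr_ge0 ?sqr_ge0 ?(ltW d'0).
  clear; lra.
- by rewrite K0.
- have -> : (1 + d) * energy_coef R n / s ^+ 2 = (1 - d) ^+ 2 * n%:R ^+ 2 / (1 + d).
    by rewrite rt2 /s /kap; field; rewrite !gt_eqF.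
  rewrite ler_pdivrMr// ler_peMr//; last by rewrite lerDl ltW.
  by rewrite mulr_ge0 ?sqr_ge0.
- rewrite -e6; apply: en => //.
  rewrite -[leLHS]expRK ler_ln ?posrE ?expR_gt0//.
  exact: ltW.
- have h : 8 <= d ^+ 2 / 16 * (energy_coef R n / s).
    rewrite cE; apply: (@le_trans _ _ (d ^+ 2 / 16 * (rt * 1 / 3))).
      by move: rt_d; rewrite ler_pdivrMr ?exprn_gt0//; clear; lra.
    rewrite ler_wpM2l ?divr_ge0 ?sqr_ge0//.
    by apply: ler_pM; rewrite ?lef_pV2 ?posrE ?ler_pM2l// ?mulr1 ?invr_ge0 ltW.
  apply: (le_trans h); apply: le_trans (expR_ge1Dx _).
  by rewrite lerDr.
Qed.

(** All the conditions of [num_partitions_lower_at] hold once ln n is large; the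
    threshold Y adds up one bound for each of them. *)
Lemma num_partitions_lower (R : realType) (d : R) : 0 < d <= 1 / 2 ->
  exists Y : R, forall n, (0 < n)%N -> Y <= ln n%:R ->
    expR (2 * (1 - d) ^+ 3 * (n%:R * Num.sqrt (energy_coef R n))) <=
    (num_partitions R n n)%:R.
Proof.
move=> d01; have /andP[d0 dh] := d01; pose e := d ^+ 2 / 16 / 6.
have e0 : 0 < e by rewrite !divr_gt0// exprn_gt0.
have e6 : 6 * e = d ^+ 2 / 16 by rewrite /e; field.
clearbody e.
have [P PE P4] : exists2 P : R, pi ^+ 2 = P & 4 <= P.
  exists (pi ^+ 2) => //; rewrite (_ : 4 = 2 ^+ 2); last by ring.
  by apply: lerXn2r; rewrite ?nnegrE ?pi_ge0 ?pi_ge2.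
have [J hJ] : exists J, (1 - e) * (P / 6) <= basel_sum R J.
  have [|J hJ] := @basel_approx R (e * (P / 6)); first by rewrite mulr_gt0//; lra.
  by exists J; move: hJ; rewrite PE mulrBl mul1r.
pose D : R := 1 + P / 6; pose M : R := 2 / (e * d) + 16 * 24 / d ^+ 2.
have D0 : 0 < D by rewrite /D; lra.
have M1 : 0 < 2 / (e * d) by rewrite divr_gt0// mulr_gt0.
have M2 : 0 < 16 * 24 / d ^+ 2 by rewrite divr_gt0 ?exprn_gt0// mulr_gt0.
have Y1 : 0 < 1 / (e * d) by rewrite divr_gt0// mulr_gt0.
have Y2 : 0 <= 8 * J%:R * P / e ^+ 3.
  by rewrite divr_ge0 ?exprn_ge0 ?(ltW e0)// mulr_ge0 ?mulr_ge0//; lra.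
have Y3 : 0 < D / (3 * e) by rewrite divr_gt0// mulr_gt0.
have Y4 : 0 <= 3 * M ^+ 2 by rewrite mulr_ge0 ?sqr_ge0.
exists (1 / (e * d) + 3 + D + 8 * J%:R * P / e ^+ 3 + 3 * M ^+ 2 + D / (3 * e)).
move=> n n0 hY; have J0 := ler0n R J.
have LamE : energy_coef R n = P / 12 * (ln n%:R + D).
  by rewrite /energy_coef /D PE -addrA.
have Lam0 := energy_coef_gt0 R n0.
have rt0 : 0 <= Num.sqrt (energy_coef R n) by exact: sqrtr_ge0.
have rt2 : Num.sqrt (energy_coef R n) ^+ 2 = energy_coef R n by rewrite sqr_sqrtr// ltW.
have [y3 yD yM] : [/\ 3 <= ln n%:R :> R, D <= ln n%:R & 3 * M ^+ 2 <= ln n%:R].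
  by split; lra.
have [ya yb yd] : [/\ 1 / (e * d) <= ln n%:R, 8 * J%:R * P / e ^+ 3 <= ln n%:R
    & D / (3 * e) <= ln n%:R] by split; lra.
have y0 : 0 < ln n%:R :> R by lra.
have Lam_le : energy_coef R n <= P / 6 * ln n%:R by rewrite LamE; nra.
have Lam_ge : ln n%:R / 3 <= energy_coef R n by rewrite LamE; nra.
have rtL : Num.sqrt (energy_coef R n) <= energy_coef R n by rewrite -[leRHS]rt2; nra.
have rtM : M <= Num.sqrt (energy_coef R n).
  rewrite -[leLHS]ger0_norm; last by rewrite addr_ge0// ltW.
  by rewrite -sqrtr_sqr ler_wsqrtr//; lra.
clear hY Y1 Y2 Y3 Y4 LamE Lam0 rt0 rt2 y3 yD yM.
apply: (@num_partitions_lower_at R d e J n d01 e6 n0); rewrite ?PE//.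
- apply: (le_trans (expRN_le_inv (mulr_gt0 e0 y0))).
  rewrite -[leLHS]mul1r ler_pdivrMr ?mulr_gt0//.
  rewrite (_ : d * _ = ln n%:R * (e * d)); last by ring.
  by move: ya; rewrite ler_pdivrMr ?mulr_gt0.
- have zy := expRN_mul_le e0 y0.
  set z := expR _ in zy *; have z0 : 0 < z by exact: expR_gt0.
  move: zy Lam_le rtL yb y0 {ya yd rtM Lam_ge}.
  move: (ln n%:R : R) (Num.sqrt _) => y rt zy Lam_le rtL yb y0.
  have P0 : 0 <= P / 6 by rewrite divr_ge0// (le_trans _ P4).
  apply: (@le_trans _ _ (12 * J%:R * (P / 6) * (z * y))).
    have -> : 12 * J%:R * (P / 6) * (z * y) = 12 * J%:R * (P / 6 * y) * z by ring.
    by rewrite ler_pM2r// ler_wpM2l ?mulr_ge0//; exact: le_trans Lam_le.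
  apply: (@le_trans _ _ (12 * J%:R * (P / 6) * (4 / (e ^+ 2 * y)))).
    by rewrite ler_wpM2l// mulr_ge0// mulr_ge0.
  have -> : 12 * J%:R * (P / 6) * (4 / (e ^+ 2 * y))
      = (8 * J%:R * P / e ^+ 3) * e / y.
    by move: (J%:R : R) => b; field; rewrite !gt_eqF.
  by rewrite ler_pdivrMr// mulrC ler_pM2l.
- by apply: le_trans rtM; rewrite lerDl ltW.
- by apply: le_trans rtM; rewrite lerDr ltW.
- by move: yd; rewrite ler_pdivrMr ?mulr_gt0// mulrC.
Qed.

(** * The asymptotic formula *)

Lemma near_ln_ge (R : realType) (Z : R) :
  \forall n \near \oo, (0 < n)%N /\ Z <= ln (n%:R : R).
Proof.
exists (Num.truncn (expR Z)).+1 => // n /= Zn; split; first exact: leq_trans Zn.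
have n0 : 0 < n%:R :> R by rewrite ltr0n; exact: leq_trans Zn.
rewrite -[leLHS]expRK ler_ln ?posrE ?expR_gt0//.
by apply: (le_trans (ltW (truncnS_gt _))); rewrite ler_nat.
Qed.

Lemma sqrt_energy_coef (R : realType) n : (0 < n)%N ->
  2 * Num.sqrt (energy_coef R n) =
  pi / Num.sqrt 3%:R * Num.sqrt (ln n%:R + (1 + pi ^+ 2 / 6)).
Proof.
move=> n0; have l0 : 0 <= ln n%:R :> R by rewrite ln_ge0// ler1n.
have c0 : 0 <= pi / Num.sqrt 3%:R :> R by rewrite divr_ge0 ?pi_ge0 ?sqrtr_ge0.
have a0 : 0 <= ln n%:R + (1 + pi ^+ 2 / 6) :> R.
  by rewrite addr_ge0// addr_ge0// divr_ge0 ?sqr_ge0.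
set r := _ / _ * _; have r0 : 0 <= r by rewrite mulr_ge0 ?sqrtr_ge0.
have -> : energy_coef R n = (r / 2) ^+ 2.
  rewrite /r !expr_div_n exprMn expr_div_n !sqr_sqrtr ?ler0n// /energy_coef.
  by move: (pi ^+ 2 : R) => P; field.
by rewrite sqrtr_sqr ger0_norm ?divr_ge0// mulrC divfK ?pnatr_eq0.
Qed.

Lemma ln_num_partitions_upper (R : realType) n : (1 < n)%N ->
  (0 < num_partitions R n n)%N ->
  ln (num_partitions R n n)%:R / (n%:R * Num.sqrt (ln n%:R)) - pi / Num.sqrt 3%:R
  <= pi / Num.sqrt 3%:R * (1 + pi ^+ 2 / 6) / ln n%:R :> R.
Proof.
move=> n1 p0; have n0 : (0 < n)%N by exact: ltnW.
have N0 : 0 < n%:R :> R by rewrite ltr0n.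
have l0 : 0 < ln n%:R :> R by rewrite ln_gt0// ltr1n.
have := num_partitions_upper R n0.
rewrite -[(num_partitions R n n)%:R]lnK ?posrE ?ltr0n// ler_expR expRK.
rewrite mulrAC (sqrt_energy_coef R n0).
set c := pi / _; have c0 : 0 <= c by rewrite divr_ge0 ?pi_ge0 ?sqrtr_ge0.
set D := 1 + pi ^+ 2 / 6; have D0 : 0 <= D by rewrite addr_ge0// divr_ge0 ?sqr_ge0.
clearbody c D; move: (ln n%:R : R) l0 => y y0.
set q := Num.sqrt y; have q0 : 0 < q by rewrite sqrtr_gt0.
have hs : Num.sqrt (y + D) <= q * (1 + D / y).
  have k0 : 0 <= q * (1 + D / y).
    by rewrite mulr_ge0 ?(ltW q0)// addr_ge0// divr_ge0// ltW.
  rewrite -[leRHS]ger0_norm// -sqrtr_sqr ler_wsqrtr// exprMn sqr_sqrtr ?(ltW y0)//.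
  have -> : y * (1 + D / y) ^+ 2 = y + 2 * D + D * (D / y) by field; rewrite gt_eqF.
  have : 0 <= D * (D / y) by rewrite mulr_ge0// divr_ge0// ltW.
  by lra.
move=> h; rewrite lerBlDr ler_pdivrMr ?mulr_gt0//; apply: (le_trans h).
have -> : (c * D / y + c) * (n%:R * q) = c * (q * (1 + D / y)) * n%:R.
  by field; rewrite gt_eqF.
by rewrite ler_wpM2r// ?ler_wpM2l// ltW.
Qed.

Lemma ln_num_partitions_lower (R : realType) (d : R) : 0 < d <= 1 / 2 ->
  \forall n \near \oo, [/\ (1 < n)%N, (0 < num_partitions R n n)%N &
  - (3 * d * (pi / Num.sqrt 3%:R)) <=
  ln (num_partitions R n n)%:R / (n%:R * Num.sqrt (ln n%:R)) - pi / Num.sqrt 3%:R].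
Proof.
move=> d01; have [Y hY] := num_partitions_lower d01.
near=> n.
have [n0 Yn] : (0 < n)%N /\ Y <= ln (n%:R : R) by near: n; exact: near_ln_ge.
have n1 : (1 < n)%N by near: n; exists 2%N.
have h := hY n n0 Yn.
have p0 : (0 < num_partitions R n n)%N.
  by rewrite -(ltr_nat R); apply: lt_le_trans h; exact: expR_gt0.
split=> //; move: h.
have N0 : 0 < n%:R :> R by rewrite ltr0n.
have l0 : 0 < ln n%:R :> R by rewrite ln_gt0// ltr1n.
rewrite -[(num_partitions R n n)%:R]lnK ?posrE ?ltr0n// ler_expR expRK.
have -> : 2 * (1 - d) ^+ 3 * (n%:R * Num.sqrt (energy_coef R n)) =
  (1 - d) ^+ 3 * n%:R * (2 * Num.sqrt (energy_coef R n)) by ring.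
rewrite (sqrt_energy_coef R n0).
set c := pi / _; have c0 : 0 <= c by rewrite divr_ge0 ?pi_ge0 ?sqrtr_ge0.
set D := 1 + pi ^+ 2 / 6; have D0 : 0 <= D by rewrite addr_ge0// divr_ge0 ?sqr_ge0.
clearbody c D; move: (ln n%:R : R) l0 => y y0 h.
have q0 : 0 < Num.sqrt y by rewrite sqrtr_gt0.
rewrite lerBrDr ler_pdivlMr ?mulr_gt0//; apply: le_trans h.
have -> : (- (3 * d * c) + c) * (n%:R * Num.sqrt y) =
  (1 - 3 * d) * (n%:R * (c * Num.sqrt y)) by ring.
have [d0 dh] := andP d01.
apply: (@le_trans _ _ ((1 - d) ^+ 3 * (n%:R * (c * Num.sqrt y)))).
  rewrite ler_wpM2r ?mulr_ge0 ?(ltW q0)//.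
  have : 0 <= d ^+ 2 * (3 - d) by rewrite mulr_ge0 ?sqr_ge0//; lra.
  by lra.
rewrite -[leRHS]mulrA ler_wpM2l ?exprn_ge0//; first by lra.
by rewrite !ler_wpM2l ?(ltW N0)// ler_wsqrtr// lerDl.
Unshelve. all: by end_near. Qed.

Theorem theorem1p7 (R : realType) :
  exists eps : nat -> R,
    (eps n @[n --> \oo] --> (0 : R)) /\
    (\forall n \near \oo,
       (num_partitions R n n)%:R =
       expR ((pi / Num.sqrt 3%:R + eps n) * (n%:R * Num.sqrt (ln n%:R))) :> R).
Proof.
exists (fun n => ln (num_partitions R n n)%:R / (n%:R * Num.sqrt (ln n%:R))
  - pi / Num.sqrt 3%:R); split; last first.
  have h2 : 0 < (1 / 2 : R) <= 1 / 2 by lra.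
  near=> n; have [n1 p0 _] : [/\ (1 < n)%N, (0 < num_partitions R n n)%N &
      - (3 * (1 / 2) * (pi / Num.sqrt 3%:R)) <= ln (num_partitions R n n)%:R /
      (n%:R * Num.sqrt (ln n%:R)) - pi / Num.sqrt 3%:R :> R].
    by near: n; exact: ln_num_partitions_lower.
  have b0 : 0 < n%:R * Num.sqrt (ln n%:R) :> R.
    by rewrite mulr_gt0 ?sqrtr_gt0 ?ln_gt0 ?ltr1n// ltr0n ltnW.
  by rewrite addrC subrK divfK ?gt_eqF// lnK// posrE ltr0n.
set c := pi / Num.sqrt 3%:R.
have c0 : 0 < c by rewrite divr_gt0 ?pi_gt0 ?sqrtr_gt0.
apply/cvgrPdist_le => e e0.
pose d := Num.min (1 / 2) (e / (3 * c)).
have d01 : 0 < d <= 1 / 2.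
  apply/andP; split; last by rewrite /d ge_min lexx.
  rewrite /d lt_min; apply/andP; split; first by lra.
  by rewrite divr_gt0// mulr_gt0.
have dc : 3 * d * c <= e.
  have c3 : 0 < 3 * c by rewrite mulr_gt0.
  have dle : d <= e / (3 * c) by rewrite /d ge_min lexx orbT.
  rewrite (ler_pdivlMr _ _ c3) in dle; apply: le_trans dle.
  by rewrite [leRHS]mulrCA -[leLHS]mulrA.
near=> n.
have [n1 p0 lo] : [/\ (1 < n)%N, (0 < num_partitions R n n)%N &
    - (3 * d * c) <= ln (num_partitions R n n)%:R /
    (n%:R * Num.sqrt (ln n%:R)) - c].
  by near: n; exact: ln_num_partitions_lower.
have up := ln_num_partitions_upper n1 p0.
have [_ hn] : (0 < n)%N /\ c * (1 + pi ^+ 2 / 6) / e <= ln (n%:R : R).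
  by near: n; exact: near_ln_ge.
have l0 : 0 < ln n%:R :> R by rewrite ln_gt0// ltr1n.
rewrite sub0r normrN ler_norml; apply/andP; split; first by lra.
apply: (le_trans up); by rewrite ler_pdivrMr// [leRHS]mulrC -ler_pdivrMr.
Unshelve. all: by end_near. Qed.
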